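(* Let the optimizer have $m=2$ actions $N,Y$, let the learner have $n=3$ actions $A,B,C$, and let $u_L$ be given by $u_L(N,A)=0$, $u_L(Y,A)=0$, $u_L(N,B)=-1/6$, $u_L(Y,B)=1/3$, $u_L(N,C)=-1/2$, $u_L(Y,C)=1/2$. If $\mathcal{A}$ is an $\mathsf{FTRL}$ algorithm, then $\mathcal{M}(\mathcal{A})=\mathcal{M}_{\mathrm{MB}}$.
   Context: $\Delta_m,\Delta_n$ are the simplices of mixed strategies of the optimizer and the learner; $\Delta_{mn}$ is the set of probability distributions over pairs of (optimizer, learner) actions; $x\otimes y$ is the product distribution; $u_L$ is extended bilinearly. $\mathrm{BR}_L(x)=\arg\max_{j\in[n]}u_L(x,j)$ (set of pure learner actions); $\mathrm{BR}_L(0)$ is the set of all learner actions. Menus. A learning algorithm $\mathcal{A}=\{A^T\}_{T\in\mathbb{N}}$ consists, for each horizon $T$, of functions $A^T_t:\Delta_m^{t-1}\to\Delta_n$; against $(x_1,\dots,x_T)\in\Delta_m^T$ the learner plays $y_t=A^T_t(x_1,\dots,x_{t-1})$. $\mathcal{M}(A^T)$ is the convex hull of all points $\frac1T\sum_{t=1}^T x_t\otimes y_t$ over all optimizer sequences. The asymptotic menu $\mathcal{M}(\mathcal{A})$ is the (closed) limit of $\mathcal{M}(A^1),\mathcal{M}(A^2),\dots$ in the Hausdorff metric. FTRL. For $\eta>0$ and a bounded, strongly convex regularizer $R:\Delta_n\to\mathbb{R}$, $\mathsf{FTRL}_T(\eta,R)$ is the horizon-$T$ algorithm that plays $y_t=\arg\max_{y\in\Delta_n}\left(\sum_{s=1}^{t-1}u_L(x_s,y)-\frac{R(y)}{\eta}\right)$.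 $\mathcal{A}$ is an $\mathsf{FTRL}$ algorithm if there are a fixed (independent of $T$) bounded, strongly convex regularizer $R:\Delta_n\to\mathbb{R}$ and learning rates $\eta_T>0$ with $\eta_T=1/o(T)$ (i.e. $1/\eta_T=o(T)$) such that $A^T=\mathsf{FTRL}_T(\eta_T,R)$ for all $T>0$. Mean-based menu. A trajectory is a finite non-empty list $\tau=\{(x_1,t_1,b_1),\dots,(x_k,t_k,b_k)\}$ with $x_i\in\Delta_m$, $t_i\in\mathbb{R}_+$, $b_i\in[n]$. Put $\overline{x}_i=\sum_{j=1}^i x_jt_j/\sum_{j=1}^it_j$ and $\overline{x}_0=0$. $\tau$ is valid if $b_i\in\mathrm{BR}_L(\overline{x}_{i-1})$ and $b_i\in\mathrm{BR}_L(\overline{x}_i)$ for every $i$. Its profile is $\mathrm{Prof}(\tau)=\sum_{i=1}^kt_i(x_i\otimes b_i)/\sum_{i=1}^kt_i\in\Delta_{mn}$. $\mathcal{M}_{\mathrm{MB}}$ is the convex closure (closed convex hull) of $\{\mathrm{Prof}(\tau):\tau\text{ valid}\}$.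
   Formalization: The learning rates are also assumed to satisfy η_T → 0. With only 1/η_T = o(T) the claim is false: for R(y)=|y|²/2 and η_T=100 the optimizer can force average play tending to (Y,A)/3+2(N,B)/3, where u_L=-1/9, while u_L ≥ 0 on M_MB. *)

(* Defs.v *)
From HB Require Import structures.
From mathcomp Require Import all_boot all_order all_algebra.
From mathcomp Require Import all_classical all_reals all_analysis.

Set Implicit Arguments.
Unset Strict Implicit.
Unset Printing Implicit Defensive.

Import Order.TTheory GRing.Theory Num.Theory.
Import numFieldNormedType.Exports.

Local Open Scope classical_set_scope.
Local Open Scope ring_scope.

(* Mixed strategies are row vectors; a distribution over pairs of (optimizer,
   learner) actions is an m x n matrix. *)

Definition simplex (R : realType) (n : nat) : set 'rV[R]_n :=
  [set x | (forall j, 0 <= x 0 j) /\ \sum_(j < n) x 0 j = 1].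

Definition pure (R : realType) (n : nat) (j : 'I_n) : 'rV[R]_n := delta_mx 0 j.

Definition prod_distr (R : realType) (m n : nat)
    (x : 'rV[R]_m) (y : 'rV[R]_n) : 'M[R]_(m, n) :=
  \matrix_(i < m, j < n) (x 0 i * y 0 j).

Definition payoff (R : realType) (m n : nat) (u : 'M[R]_(m, n))
    (x : 'rV[R]_m) (y : 'rV[R]_n) : R :=
  \sum_(i < m) \sum_(j < n) x 0 i * y 0 j * u i j.

(* At x = 0 every payoff vanishes, so BR u 0 is the set of all actions. *)
Definition BR (R : realType) (m n : nat) (u : 'M[R]_(m, n))
    (x : 'rV[R]_m) : set 'I_n :=
  [set j | forall k, payoff u x (pure R k) <= payoff u x (pure R j)].

Definition convex_hull (R : realType) (M : lmodType R) (S : set M) : set M :=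
  smallest (fun C : set M => convex_set (C : set (convex_lmodType M))) S.

(* On matrices the distance is the entrywise sup distance; the choice of norm
   does not affect Hausdorff convergence. *)
Definition hausdorff_dist (R : realType) (X : pseudoMetricType R)
    (S S' : set X) : \bar R :=
  maxe (ereal_sup [set edist_inf S' p | p in S])
       (ereal_sup [set edist_inf S p | p in S']).

(* [play T h] is the learner's strategy at round t = size h + 1 with horizon T
   against the optimizer's history h = [:: x_1; ...; x_(t-1)].  Its values at
   rounds t > T are irrelevant. *)
Record learning_algorithm (R : realType) (m n : nat) := LearningAlgorithm {
  play :> nat -> seq 'rV[R]_m -> 'rV[R]_n;
  play_simplex : forall (T : nat) (h : seq 'rV[R]_m),
    (forall x, x \in h -> simplex x) -> simplex (play T h) }.

Definition average_play (R : realType) (m n : nat)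
    (A : learning_algorithm R m n) (T : nat) (x : T.-tuple 'rV[R]_m) :
    'M[R]_(m, n) :=
  (T%:R)^-1 *: \sum_(t < T) prod_distr (tnth x t) (A T (take t x)).

Definition menu (R : realType) (m n : nat) (A : learning_algorithm R m n)
    (T : nat) : set 'M[R]_(m, n) :=
  convex_hull [set average_play A x | x in
    [set x : T.-tuple 'rV[R]_m | forall t, simplex (tnth x t)]].

(* Hausdorff limits are unique among closed sets, so this determines M. *)
Definition is_asymptotic_menu (R : realType) (m n : nat)
    (A : learning_algorithm R m n) (M : set 'M[R]_(m, n)) : Prop :=
  closed M /\ hausdorff_dist (menu A T) M @[T --> \oo] --> 0%E.

Definition bounded_regularizer (R : realType) (n : nat)
    (reg : 'rV[R]_n -> R) : Prop :=
  exists B : R, forall y, simplex y -> `|reg y| <= B.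

Definition strongly_convex (R : realType) (n : nat)
    (reg : 'rV[R]_n -> R) : Prop :=
  exists2 mu : R, 0 < mu &
    forall (y z : 'rV[R]_n) (l : R), simplex y -> simplex z ->
      0 <= l <= 1 ->
      reg (l *: y + (1 - l) *: z) <=
        l * reg y + (1 - l) * reg z
        - mu / 2 * l * (1 - l) * \sum_(j < n) (y 0 j - z 0 j) ^+ 2.

Definition ftrl_objective (R : realType) (m n : nat) (u : 'M[R]_(m, n))
    (eta : R) (reg : 'rV[R]_n -> R) (h : seq 'rV[R]_m) (y : 'rV[R]_n) : R :=
  \sum_(x <- h) payoff u x y - reg y / eta.

Definition plays_FTRL (R : realType) (m n : nat) (u : 'M[R]_(m, n))
    (T : nat) (eta : R) (reg : 'rV[R]_n -> R)
    (AT : seq 'rV[R]_m -> 'rV[R]_n) : Prop :=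
  forall h : seq 'rV[R]_m, (size h < T)%N ->
    (forall x, x \in h -> simplex x) ->
    simplex (AT h) /\
    forall y, simplex y ->
      ftrl_objective u eta reg h y <= ftrl_objective u eta reg h (AT h).

(* These conditions do not force eta_T -> 0.  With eta_T bounded away from 0, e.g.
   a large constant, FTRL behaves like follow-the-leader and has linear regret,
   whereas every point of the mean-based menu has zero regret. *)
Definition FTRL_rates (R : realType) (eta : nat -> R) : Prop :=
  (forall T, (0 < T)%N -> 0 < eta T) /\
  (eta T)^-1 / T%:R @[T --> \oo] --> (0 : R).

Definition is_FTRL (R : realType) (m n : nat) (u : 'M[R]_(m, n))
    (reg : 'rV[R]_n -> R) (eta : nat -> R)
    (A : learning_algorithm R m n) : Prop :=
  [/\ bounded_regularizer reg, strongly_convex reg, FTRL_rates eta &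
      forall T, (0 < T)%N -> plays_FTRL u T (eta T) reg (A T)].

(* A step (x_i, t_i, b_i) of a trajectory. *)
Definition step (R : realType) (m n : nat) : Type :=
  ('rV[R]_m * R * 'I_n)%type.

Definition step_mix (R : realType) (m n : nat) (s : step R m n) : 'rV[R]_m :=
  s.1.1.
Definition step_time (R : realType) (m n : nat) (s : step R m n) : R := s.1.2.
Definition step_resp (R : realType) (m n : nat) (s : step R m n) : 'I_n := s.2.

(* The time-average of the first i optimizer strategies; it is 0 for i = 0. *)
Definition traj_mean (R : realType) (m n : nat) (tau : seq (step R m n))
    (i : nat) : 'rV[R]_m :=
  (\sum_(s <- take i tau) step_time s)^-1 *:
    \sum_(s <- take i tau) step_time s *: step_mix s.

(* Durations are positive: this makes all the time-averages well defined, and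
   removing zero-length steps changes neither validity nor the profile. *)
Definition valid_traj (R : realType) (m n : nat) (u : 'M[R]_(m, n))
    (tau : seq (step R m n)) : Prop :=
  tau <> [::] /\
  forall (i : nat) (x : 'rV[R]_m) (t : R) (b : 'I_n),
    onth tau i = Some (x, t, b) ->
    [/\ simplex x, 0 < t, BR u (traj_mean tau i) b &
        BR u (traj_mean tau i.+1) b].

Definition profile (R : realType) (m n : nat) (tau : seq (step R m n)) :
    'M[R]_(m, n) :=
  (\sum_(s <- tau) step_time s)^-1 *:
    \sum_(s <- tau) step_time s *:
      prod_distr (step_mix s) (pure R (step_resp s)).

Definition M_MB (R : realType) (m n : nat) (u : 'M[R]_(m, n)) :
    set 'M[R]_(m, n) :=
  closure (convex_hull [set profile tau | tau in valid_traj u]).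

Definition actN : 'I_2 := @Ordinal 2 0 isT.
Definition actY : 'I_2 := @Ordinal 2 1 isT.
Definition actA : 'I_3 := @Ordinal 3 0 isT.
Definition actB : 'I_3 := @Ordinal 3 1 isT.
Definition actC : 'I_3 := @Ordinal 3 2 isT.

(* Main.v *)
(* Write payoffs relative to B: with N, Y the weights of the optimizer's strategy, A gains
   a = (N - 2 Y) / 6 over B and C gains c = (Y - 2 N) / 6, and a + c < 0.  Let alpha and gamma be
   the cumulative values of a and c, and let S_A (S_C) be the part of alpha (gamma) collected
   with the weight that the learner puts on A (C).  Along a valid trajectory A is played exactly
   while alpha >= 0, so S_A = max(0, alpha), and likewise S_C = max(0, gamma).  These two
   identities confine the profile to a polytope with eight vertices, each of which is the profile
   of a valid trajectory with two steps; so M_MB is that polytope.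

   FTRL satisfies both identities up to o(T).  The FTRL potential Phi changes by
   a p + c q up to a small error (p, q the weights of A and C), which controls S_A + S_C.  To
   separate the two parts, Phi is multiplied by a cutoff that moves only where alpha is slightly
   negative: there Phi is small, and at all times at least one of p and q is small, because
   alpha + gamma = - t / 6.  Conversely a vertex is approached by playing, for two halves of
   the horizon, two fixed strategies that are perturbed so as to break the ties. *)
Require Import Defs.
From HB Require Import structures.
From mathcomp Require Import all_boot all_order all_algebra.
From mathcomp Require Import all_classical all_reals all_analysis.
From mathcomp Require Import zify ring lra.

Set Implicit Arguments.
Unset Strict Implicit.
Unset Printing Implicit Defensive.

Import Order.TTheory GRing.Theory Num.Theory.
Import numFieldNormedType.Exports.

Local Open Scope classical_set_scope.
Local Open Scope ring_scope.

(** * The potential argument for one of the two extreme actions *)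

Definition ramp (R : realType) (D x : R) : R :=
  Num.max 0 (Num.min 1 (x / D + 2)).

Lemma ramp_bounds (R : realType) (D x : R) : 0 <= ramp D x <= 1.
Proof. by rewrite /ramp /Num.max /Num.min; do !case: ifP; lra. Qed.

Lemma ramp_eq0 (R : realType) (D x : R) : 0 < D -> x <= - (2 * D) -> ramp D x = 0.
Proof.
move=> D0 xD; have : x / D <= - 2 by rewrite ler_pdivrMr//; lra.
by rewrite /ramp /Num.max /Num.min; do !case: ifP; lra.
Qed.

Lemma ramp_eq1 (R : realType) (D x : R) : 0 < D -> - D <= x -> ramp D x = 1.
Proof.
move=> D0 xD; have : - 1 <= x / D by rewrite ler_pdivlMr//; lra.
by rewrite /ramp /Num.max /Num.min; do !case: ifP; lra.
Qed.

Lemma ramp_lipschitz (R : realType) (D x y : R) : 0 < D ->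
  `|ramp D x - ramp D y| <= `|x - y| / D.
Proof.
move=> D0; have -> : `|x - y| / D = `|x / D - y / D|.
  by rewrite -mulrBl normrM (@gtr0_norm _ D^-1) ?invr_gt0.
rewrite /ramp; move: (x / D) (y / D) => {D0} {}x {}y.
rewrite /Num.max /Num.min; case: (ltP 1 (x + 2)) => ?;
  case: (ltP 1 (y + 2)) => ?; do !case: ifP => *; rewrite ler_norml;
  case: (ler0P (x - y)) => *; apply/andP; split; lra.
Qed.

(* [w_t Phi_t], where the weight [w_t] is 1 for [alpha_t >= - D] and 0 for
   [alpha_t <= - 2 D], telescopes up to small errors: [Phi_t] is small while the
   weight moves, [q_t] is small where the weight is positive, and [p_t] is small
   where the weight is not 1.  The early steps, on which [gamma_t] need not
   be very negative, are estimated trivially. *)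
Lemma half_regret_step (R : realType) (D G kappa a c p q al0 ga0 al1 ga1 P0 P1 : R)
    (s : R) (early : bool) :
  1 <= D -> 0 <= G -> 0 <= kappa ->
  `|a| <= 1 / 3 -> `|c| <= 1 / 3 -> 0 <= p -> 0 <= q -> p + q <= 1 ->
  al1 = al0 + a -> ga1 = ga0 + c -> al0 + ga0 = - s / 6 -> al1 + ga1 = - (s + 1) / 6 ->
  0 <= s -> (~~ early -> 24 * D <= s) ->
  P1 - P0 - kappa <= p * a + q * c ->
  - G <= P1 -> (forall z : R, 0 <= z -> al1 <= z -> ga1 <= z -> P1 <= z + G) ->
  - p * al0 <= G -> - q * ga0 <= G ->
  ramp D al1 * P1 - ramp D al0 * P0 - (kappa + 3 * G / D) - 2 * early%:R <= p * a.
Proof.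
move=> D1 G0 k0 an cn p0 q0 pq e1 e2 s0 s1 sge late Pup Plo Phi pal qga.
have D0 : 0 < D by lra.
have [/andP[w0 w1] /andP[v0 v1]] := (ramp_bounds D al0, ramp_bounds D al1).
have GD0 : 0 <= G / D by rewrite divr_ge0// ltW.
(* With [w0], [w1] for the two weights, [w1 * P1 - w0 * P0] equals
   [w0 * (P1 - P0) + (w1 - w0) * P1]. After [Pup], three errors separate this from [p * a]; [i1],
   [i2], [i3] bound them, and the multiples 1, 1/2 and 1 of [G / D] fit into 3. *)
have i1 : (1 - ramp D al0) * (p * a) >= - (G / D).
  have [h|h] := leP (- D) al0; first by rewrite ramp_eq1// subrr mul0r oppr_le0.
  have pG : p <= G / D.
    rewrite ler_pdivlMr// (le_trans _ pal)// mulNr -mulrN ler_wpM2l//.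
    by lra.
  move: an; rewrite ler_norml => /andP[an _].
  have pa : - (G / D) <= p * a.
    have : 0 <= p * (a + 1 / 3) by apply: mulr_ge0; lra.
    lra.
  have : 0 <= (1 - ramp D al0) * (p * a + G / D) by apply: mulr_ge0; lra.
  have : 0 <= ramp D al0 * (G / D) by exact: mulr_ge0.
  lra.
have i2 : ramp D al0 * (q * c) <= G / (2 * D) + early%:R.
  have G2D : 0 <= G / (2 * D) by rewrite divr_ge0//; lra.
  have [h|h] := leP al0 (- (2 * D)).
    by rewrite ramp_eq0// mul0r addr_ge0.
  move: cn; rewrite ler_norml => /andP[_ cn].
  have qc : q * c <= q / 3.
    have : 0 <= q * (1 / 3 - c) by apply: mulr_ge0; lra.
    lra.
  have wqc : ramp D al0 * (q * c) <= q / 3.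
    have : 0 <= ramp D al0 * (q / 3 - q * c) by apply: mulr_ge0; lra.
    have : 0 <= (1 - ramp D al0) * (q / 3) by apply: mulr_ge0; lra.
    lra.
  case: early late => [_|/(_ isT) late] /=; first by lra.
  (* Here [al0 > - 2 D] and [s >= 24 D], so [ga0 = - s / 6 - al0] lies below [- 2 D]. *)
  have qG : q <= G / (2 * D).
    rewrite ler_pdivlMr; last lra.
    by rewrite (le_trans _ qga)// mulNr -mulrN ler_wpM2l//; lra.
  lra.
have i3 : (ramp D al1 - ramp D al0) * P1 <= G / D + early%:R.
  have e0 : (0 : R) <= early%:R by rewrite ler0n.
  have [->|neq] := eqVneq (ramp D al1) (ramp D al0).
    by rewrite subrr mul0r addr_ge0.
  have lip := ramp_lipschitz al1 al0 D0.
  have da : `|al1 - al0| = `|a| by rewrite e1; congr `|_|; lra.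
  have lip3 : `|ramp D al1 - ramp D al0| <= 1 / 3 / D.
    by rewrite (le_trans lip)// da ler_pM2r ?invr_gt0.
  have : - (3 * D) <= al1 <= 0.
    move: an; rewrite ler_norml => /andP[an1 an2].
    have [h|h] := leP al1 (- (3 * D)).
      by move: neq; rewrite !ramp_eq0 ?eqxx//; lra.
    have [h'|h'] := leP al1 0; first by rewrite ltW.
    by move: neq; rewrite !ramp_eq1 ?eqxx//; lra.
  move=> /andP[b1 b2].
  (* Late, [al1 >= - 3 D] makes [ga1] negative and [z = 0] bounds [P1]; early, [z = 3 D] does. The
     slope of the ramp turns this [3 D] into a cost of 1. *)
  have P1abs : `|P1| <= G + 3 * D * early%:R.
    have up : P1 <= 3 * D * early%:R + G.
      apply: Phi; first by rewrite mulr_ge0//; lra.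
        by rewrite (le_trans b2)// mulr_ge0//; lra.
      case: early late e0 {i2} => [_|/(_ isT) late] _ /=; lra.
    have : 0 <= 3 * D * early%:R by rewrite mulr_ge0//; lra.
    by rewrite ler_norml => ?; apply/andP; split; lra.
  rewrite (le_trans (ler_norm _))// normrM.
  rewrite (le_trans (ler_pM _ _ lip3 P1abs))//.
  have -> : 1 / 3 / D * (G + 3 * D * early%:R) = G / D / 3 + early%:R.
    by field; lra.
  lra.
have G2 : G / (2 * D) = G / D / 2 by field; lra.
rewrite G2 in i2.
have -> : 3 * G / D = 3 * (G / D) by rewrite mulrA.
have : 0 <= ramp D al0 * (p * a + q * c - (P1 - P0 - kappa)).
  by apply: mulr_ge0; lra.
have : 0 <= (1 - ramp D al0) * kappa by apply: mulr_ge0; lra.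
lra.
Qed.

(** Sums [half_regret_step], the rounds before [M] being the early ones. The two ends of the
    telescoping sum cost [G] each. *)
Lemma half_regret (R : realType) (D G kappa : R) (n M : nat)
    (a c p q al ga Phi : nat -> R) :
  1 <= D -> 24 * D <= M%:R -> 0 <= G -> 0 <= kappa ->
  al 0%N = 0 -> ga 0%N = 0 ->
  (forall t, (t <= n)%N -> al t + ga t = - t%:R / 6) ->
  (forall t, (t < n)%N -> [/\ `|a t| <= 1 / 3, `|c t| <= 1 / 3,
     al t.+1 = al t + a t, ga t.+1 = ga t + c t &
     Phi t.+1 - Phi t - kappa <= p t * a t + q t * c t]) ->
  (forall t, (t <= n)%N -> [/\ 0 <= p t, 0 <= q t, p t + q t <= 1,
     - p t * al t <= G & - q t * ga t <= G]) ->
  (forall t, (t <= n)%N -> [/\ - G <= Phi t, al t - G <= Phi t &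
     forall z : R, 0 <= z -> al t <= z -> ga t <= z -> Phi t <= z + G]) ->
  Num.max 0 (al n) - 2 * G - n%:R * (kappa + 3 * G / D) - 2 * M%:R <=
  \sum_(0 <= t < n) p t * a t.
Proof.
move=> D1 DM G0 k0 al0 ga0 sumE steps pqs Phis.
have D0 : 0 < D by lra.
(* [minn m M] counts the early rounds so far. [Phi 0] appears without a weight because [al 0 = 0]
   has weight 1. *)
have rec m : (m <= n)%N ->
    ramp D (al m) * Phi m - Phi 0 - m%:R * (kappa + 3 * G / D)
      - 2 * (minn m M)%:R <= \sum_(0 <= t < m) p t * a t.
  elim: m => [_|m IH mn].
    by rewrite big_geq// al0 ramp_eq1 ?min0n//; lra.
  rewrite big_nat_recr//=; have {}IH := IH (ltnW mn).
  have [an cn alE gaE PhE] := steps m mn.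
  have [p0 q0 pq pal qga] := pqs m (ltnW mn).
  have [Ph1 _ Ph2] := Phis m.+1 mn.
  have mS : m.+1%:R = m%:R + 1 :> R by rewrite -addn1 natrD.
  have s1 : al m.+1 + ga m.+1 = - (m%:R + 1) / 6 by rewrite sumE// mS.
  have late : ~~ (m < M)%N -> 24 * D <= m%:R.
    by rewrite -leqNgt => Mm; rewrite (le_trans DM)// ler_nat.
  have := half_regret_step D1 G0 k0 an cn p0 q0 pq alE gaE (sumE m (ltnW mn)) s1
    (ler0n _ _) late PhE Ph1 Ph2 pal qga.
  have mE : (minn m.+1 M = minn m M + (m < M))%N.
    have [h|h] := ltnP m M.
      by rewrite (minn_idPl h) addn1.
    by rewrite (minn_idPr (leqW h)) addn0.
  rewrite mE natrD mS.
  lra.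
have := rec n (leqnn n).
have [Ph0 _ Ph0'] := Phis 0%N (leq0n _).
have {}Ph0' := Ph0' 0 (lexx _); rewrite al0 ga0 in Ph0'.
have {Ph0'} Ph0' := Ph0' (lexx _) (lexx _).
have [Phn1 Phn2 _] := Phis n (leqnn n).
have mM : (minn n M)%:R <= M%:R :> R by rewrite ler_nat geq_minr.
have /andP[w0 w1] := ramp_bounds D (al n).
(* Above [- D] the weight is 1 and both lower bounds on [Phi n] apply; below, the positive part is 0
   and a weight at most 1 cannot push the product under [- G]. *)
have : Num.max 0 (al n) - G <= ramp D (al n) * Phi n.
  have [h|h] := leP (- D) (al n).
    by rewrite ramp_eq1// mul1r /Num.max; case: ifP; lra.
  by rewrite /Num.max; case: ifP => ?; nra.
lra.
Qed.

(** * Convexity *)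

(** Convexity with a real coefficient and its bounds instead of the bundled interval element that
    [convex_set] uses. *)
Definition convex_subset (R : realType) (V : lmodType R) (S : set V) : Prop :=
  forall x y (l : R), S x -> S y -> 0 <= l <= 1 -> S (l *: x + (1 - l) *: y).

Lemma convex_hull_convex (R : realType) (V : lmodType R) (S : set V) :
  convex_subset (convex_hull S).
Proof.
move=> x y l Sx Sy /andP[l0 l1] C [cC SC].
have := cC x y (Itv01 l0 l1); rewrite !inE; apply; [exact: Sx|exact: Sy].
Qed.

Lemma convex_hull_min (R : realType) (V : lmodType R) (S C : set V) :
  convex_subset C -> S `<=` C -> convex_hull S `<=` C.
Proof.
move=> cC SC x; apply; split => // y z l; rewrite !inE => Cy Cz.
by apply: cC => //; apply/andP; split.
Qed.

Lemma convex_hull_sub (R : realType) (V : lmodType R) (S : set V) :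
  S `<=` convex_hull S.
Proof. by move=> x Sx C [_]; apply. Qed.

(** Allows a combination of many points to be assembled one term at a time, without normalising the
    partial weights. *)
Lemma dilate_add (R : realType) (V : lmodType R) (S : set V) :
  convex_subset S ->
  forall (a b : R) (x y : V), 0 <= a -> 0 <= b -> S x -> S y ->
  exists2 z, S z & a *: x + b *: y = (a + b) *: z.
Proof.
move=> cS a b x y a0 b0 Sx Sy.
have [ab0|ab0] := eqVneq (a + b) 0.
  exists x => //; have -> : a = 0 by lra.
  by have -> : b = 0 by [lra]; rewrite addr0 !scale0r addr0.
have abp : 0 < a + b by rewrite lt_def ab0 addr_ge0.
exists ((a / (a + b)) *: x + (1 - a / (a + b)) *: y).
  apply: cS => //; rewrite divr_ge0//= ?addr_ge0// ler_pdivrMr// mul1r; lra.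
rewrite scalerDr !scalerA mulrCA divff// mulr1; congr (_ + _ *: _).
by field.
Qed.

(** * The polytope *)

Lemma sum_optimizer (V : nmodType) (F : 'I_2 -> V) :
  \sum_(i < 2) F i = F actN + F actY.
Proof. by rewrite !big_ord_recl big_ord0 addr0; do 2?congr (_ + _); congr F; exact: val_inj. Qed.

Lemma sum_learner (V : nmodType) (F : 'I_3 -> V) :
  \sum_(j < 3) F j = F actA + F actB + F actC.
Proof.
rewrite !big_ord_recl big_ord0 addr0 addrA.
by do 2?congr (_ + _); congr F; exact: val_inj.
Qed.

Lemma optimizer_ind (P : 'I_2 -> Prop) : P actN -> P actY -> forall i, P i.
Proof.
move=> PN PY [[|[|//]] i2].
  by rewrite (_ : Ordinal i2 = actN)//; exact: val_inj.
by rewrite (_ : Ordinal i2 = actY)//; exact: val_inj.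
Qed.

Lemma learner_ind (P : 'I_3 -> Prop) : P actA -> P actB -> P actC -> forall j, P j.
Proof.
move=> PA PB PC [[|[|[|//]]] j3].
- by rewrite (_ : Ordinal j3 = actA)//; exact: val_inj.
- by rewrite (_ : Ordinal j3 = actB)//; exact: val_inj.
- by rewrite (_ : Ordinal j3 = actC)//; exact: val_inj.
Qed.

(* For an average play [D], [advA D] and [advC D] are the payoffs that always playing A,
   resp. C, gains over always playing B against the optimizer's marginal of [D], and
   [gainA D], [gainC D] are the parts collected while the learner plays A, resp. C. *)
Definition advA (R : realType) (D : 'M[R]_(2, 3)) : R :=
  \sum_(j < 3) (D actN j - 2 * D actY j) / 6.
Definition advC (R : realType) (D : 'M[R]_(2, 3)) : R :=
  \sum_(j < 3) (D actY j - 2 * D actN j) / 6.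
Definition gainA (R : realType) (D : 'M[R]_(2, 3)) : R :=
  (D actN actA - 2 * D actY actA) / 6.
Definition gainC (R : realType) (D : 'M[R]_(2, 3)) : R :=
  (D actY actC - 2 * D actN actC) / 6.

(* By [regret_polytope_gain] and [profile_hull], these constraints for [e = 0] describe the
   mean-based menu: the learner has no swap regret from A and C to B, and the last two bound
   the cost of crossing the region where B is the best response. *)
Definition regret_polytope (R : realType) (e : R) : set 'M[R]_(2, 3) :=
  [set D | [/\ forall i j, 0 <= D i j, \sum_(i < 2) \sum_(j < 3) D i j = 1,
    2 * D actY actA - D actN actA <= e /\ 2 * D actN actC - D actY actC <= e,
    D actY actB - 2 * D actN actB - 3 * D actY actA <= e &
    D actN actB - 2 * D actY actB - 3 * D actN actC <= e]].

(** The left side of the third constraint equals [6 * (advC D - gainC D) + 12 * gainA D]. The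
    hypotheses bound [gainA D] by [max 0 (advA D) + 2 * e], which gives [6 e + 24 e] if
    [advA D <= 0]. Otherwise [12 * advA D + 6 * advC D] is added, which is at most 0 since
    [advA D + advC D = - 1 / 6] and [advA D <= 1 / 6]. The fourth constraint is symmetric. *)
Lemma regret_polytope_gain (R : realType) (e : R) (D : 'M[R]_(2, 3)) :
  (forall i j, 0 <= D i j) -> \sum_(i < 2) \sum_(j < 3) D i j = 1 ->
  Num.max 0 (advA D) - e <= gainA D -> Num.max 0 (advC D) - e <= gainC D ->
  gainA D + gainC D <= Num.max 0 (advA D) + Num.max 0 (advC D) + e ->
  regret_polytope (30 * e) D.
Proof.
move=> D0 D1.
have := (D0 actN actA, D0 actN actB, D0 actN actC).
have := (D0 actY actA, D0 actY actB, D0 actY actC).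
move: (D1); rewrite /advA /advC /gainA /gainC sum_optimizer !sum_learner.
rewrite /Num.max => sD [[yA yB] yC] [[nA nB] nC].
by case: ifP => hA; case: ifP => hC; do ?split => //; lra.
Qed.

(** The point [E] satisfies all four inequalities with slack 1/4, so mixing in a little of it
    restores them exactly. *)
Lemma regret_polytope_relax (R : realType) (e : R) (D : 'M[R]_(2, 3)) :
  0 <= e -> regret_polytope e D ->
  exists2 D', regret_polytope 0 D' & forall i j, `|D i j - D' i j| <= 4 * e.
Proof.
move=> e0 [D0 D1 [A1 C1] AB CB].
pose E : 'M[R]_(2, 3) := 4^-1 *: (delta_mx actN actA + delta_mx actN actB +
  delta_mx actY actB + delta_mx actY actC).
(* The solution of [(1 - l) * e = l / 4], where the slack of [E] just compensates the violation. *)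
pose l := e / (e + 4^-1).
have l0 : 0 <= l by rewrite divr_ge0//; lra.
have l1 : l <= 1 by rewrite ler_pdivrMr; lra.
have le4 : l <= 4 * e by rewrite ler_pdivrMr; nra.
have le : (1 - l) * e = l / 4 by rewrite /l; field; lra.
have slack x : x <= e -> (1 - l) * x - l / 4 <= 0.
  move=> xe; have : 0 <= (1 - l) * (e - x) by [apply: mulr_ge0; lra]; lra.
exists ((1 - l) *: D + l *: E).
  have := (slack _ A1, slack _ C1, (slack _ AB, slack _ CB)).
  move=> [[{}A1 {}C1] [{}AB {}CB]].
  split; last 3 first.
  - by rewrite !mxE /=; split; lra.
  - by rewrite !mxE /=; lra.
  - by rewrite !mxE /=; lra.
  - move=> i j; have ? := D0 i j; rewrite mxE addr_ge0// mxE mulr_ge0 ?subr_ge0//.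
    by rewrite /E !mxE; do ?rewrite ?addr_ge0 ?mulr_ge0 ?invr_ge0 ?ler0n.
  - move: D1; rewrite !sum_optimizer !sum_learner !mxE /= => D1.
    have := congr1 (fun s => (1 - l) * s) D1; lra.
have Dle1 i j : D i j <= 1.
  rewrite -D1 (bigD1 i)//= (bigD1 j)//= -addrA lerDl addr_ge0 ?sumr_ge0//.
  by move=> k _; rewrite sumr_ge0.
move=> i j; apply: le_trans le4.
have -> : D i j - ((1 - l) *: D + l *: E) i j = l * (D i j - E i j).
  have -> : ((1 - l) *: D + l *: E) i j = (1 - l) * D i j + l * E i j.
    by rewrite mxE [X in X + _]mxE [X in _ + X]mxE.
  by ring.
rewrite normrM (ger0_norm l0) ler_piMr// ler_norml.
have : 0 <= E i j <= 1.
  by rewrite /E; elim/optimizer_ind: i; elim/learner_ind: j; rewrite !mxE /=; apply/andP; split; lra.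
have := (D0 i j, Dle1 i j) => -[? ?] /andP[? ?]; apply/andP; split; lra.
Qed.

Lemma regret_polytope_mono (R : realType) (e e' : R) :
  e <= e' -> regret_polytope e `<=` regret_polytope e'.
Proof. by move=> ee D [D0 D1 [? ?] ? ?]; split => //; try split; lra. Qed.

Lemma regret_polytope_convex (R : realType) (e : R) : convex_subset (regret_polytope e).
Proof.
move=> x y l [x0 x1 [xA xC] xAB xCB] [y0 y1 [yA yC] yAB yCB] /andP[l0 l1].
have cvx (a b : R) : a <= e -> b <= e -> l * a + (1 - l) * b <= e.
  move=> ae be; have : 0 <= l * (e - a) by rewrite mulr_ge0 ?subr_ge0.
  have : 0 <= (1 - l) * (e - b) by rewrite mulr_ge0 ?subr_ge0.
  lra.
have E i j : (l *: x + (1 - l) *: y) i j = l * x i j + (1 - l) * y i j by rewrite !mxE.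
split.
- by move=> i j; rewrite E addr_ge0 ?mulr_ge0 ?subr_ge0.
- under eq_bigr do under eq_bigr do rewrite E.
  under eq_bigr do rewrite big_split/= -!mulr_sumr.
  by rewrite big_split/= -!mulr_sumr x1 y1; ring.
- rewrite !E; split; [apply: le_trans (cvx _ _ xA yA)|apply: le_trans (cvx _ _ xC yC)];
    lra.
- by rewrite !E; apply: le_trans (cvx _ _ xAB yAB); lra.
- by rewrite !E; apply: le_trans (cvx _ _ xCB yCB); lra.
Qed.

Definition mix (R : realType) (p : R) : 'rV[R]_2 :=
  \row_j (if j == actN then 1 - p else p).

Definition two_phase (R : realType) (p1 : R) (b1 : 'I_3) (p2 : R) (b2 : 'I_3) :
    'M[R]_(2, 3) :=
  2^-1 *: (prod_distr (mix p1) (pure R b1) + prod_distr (mix p2) (pure R b2)).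

Lemma two_phaseE (R : realType) (p1 : R) b1 (p2 : R) b2 i j :
  two_phase p1 b1 p2 b2 i j =
  ((if i == actN then 1 - p1 else p1) * (j == b1)%:R +
   (if i == actN then 1 - p2 else p2) * (j == b2)%:R) / 2.
Proof. by rewrite !mxE mulrC. Qed.

(** The first six have one constant strategy, pure or at a tie. In the last two, the mean starts at
    one tie of B and crosses the whole region of B up to the other tie. *)
Definition vertices (R : realType) : seq (R * 'I_3 * R * 'I_3) :=
  [:: (0, actA, 0, actA); (1 / 3, actA, 1 / 3, actA);
      (1 / 3, actB, 1 / 3, actB); (2 / 3, actB, 2 / 3, actB);
      (2 / 3, actC, 2 / 3, actC); (1, actC, 1, actC);
      (1 / 3, actA, 1, actB); (2 / 3, actC, 0, actB)].

(** Column A is split between the first two vertices, column C between the fifth and sixth, column B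
    between the third and fourth as long as neither of its entries exceeds twice the other. An
    excess is carried by the seventh or eighth vertex. *)
Lemma regret_polytope_sub (R : realType) (S : set 'M[R]_(2, 3)) :
  convex_subset S ->
  (forall (p1 : R) b1 (p2 : R) b2, (p1, b1, p2, b2) \in vertices R -> S (two_phase p1 b1 p2 b2)) ->
  regret_polytope 0 `<=` S.
Proof.
move=> cS gS.
have comb (w1 w2 w3 w4 w5 w6 w7 w8 : R) (D : 'M[R]_(2, 3)) :
    0 <= w1 -> 0 <= w2 -> 0 <= w3 -> 0 <= w4 ->
    0 <= w5 -> 0 <= w6 -> 0 <= w7 -> 0 <= w8 ->
    w1 + w2 + w3 + w4 + w5 + w6 + w7 + w8 = 1 ->
    [/\ D actN actA = w1 + 2 / 3 * w2 + 1 / 3 * w7,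
        D actN actB = 2 / 3 * w3 + 1 / 3 * w4 + 1 / 2 * w8 &
        D actN actC = 1 / 3 * w5 + 1 / 6 * w8] ->
    [/\ D actY actA = 1 / 3 * w2 + 1 / 6 * w7,
        D actY actB = 1 / 3 * w3 + 2 / 3 * w4 + 1 / 2 * w7 &
        D actY actC = 2 / 3 * w5 + w6 + 1 / 3 * w8] -> S D.
  move=> ? ? ? ? ? ? ? ? w1E [nA nB nC] [yA yB yC].
  have addE (x y : 'M[R]_(2, 3)) i j : (x + y) i j = x i j + y i j by rewrite mxE.
  have sclE a (x : 'M[R]_(2, 3)) i j : (a *: x) i j = a * x i j by rewrite mxE.
  (* [dil a x] says that [x] lies in the dilate of [S] by [a >= 0]. *)
  pose dil a x := 0 <= a /\ exists2 z, S z & x = a *: z.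
  have dilD a b x y : dil a x -> dil b y -> dil (a + b) (x + y).
    move=> [a0 [x' Sx ->]] [b0 [y' Sy ->]]; split; first exact: addr_ge0.
    by have [z Sz ->] := dilate_add cS a0 b0 Sx Sy; exists z.
  have dil1 w p1 b1 p2 b2 : 0 <= w -> (p1, b1, p2, b2) \in vertices R ->
      dil w (w *: two_phase p1 b1 p2 b2).
    by move=> w0 /gS ?; split => //; exists (two_phase p1 b1 p2 b2).
  suff [_ [z Sz]] : dil (w1 + w2 + w3 + w4 + w5 + w6 + w7 + w8)
      (w1 *: two_phase 0 actA 0 actA + w2 *: two_phase (1 / 3) actA (1 / 3) actA +
       w3 *: two_phase (1 / 3) actB (1 / 3) actB +
       w4 *: two_phase (2 / 3) actB (2 / 3) actB +
       w5 *: two_phase (2 / 3) actC (2 / 3) actC + w6 *: two_phase 1 actC 1 actC +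
       w7 *: two_phase (1 / 3) actA 1 actB + w8 *: two_phase (2 / 3) actC 0 actB).
    rewrite w1E scale1r => zE; suff -> : D = z by [].
    rewrite -zE; move: (@two_phase R) (@two_phaseE R) => tp tpE.
    apply/matrixP; elim/optimizer_ind; elim/learner_ind;
      by rewrite ?nA ?nB ?nC ?yA ?yB ?yC !addE !sclE !tpE /=; field.
  by do 7?[apply: (dilD)]; apply: (dil1); rewrite // !inE eqxx ?orbT.
move=> D [D0 D1 [A1 C1] AB CB].
have := (D0 actN actA, D0 actN actB, D0 actN actC).
have := (D0 actY actA, D0 actY actB, D0 actY actC).
move=> [[yA yB] yC] [[nA nB] nC]; move: D1; rewrite sum_optimizer !sum_learner => D1.
have [h1|h1] := leP (D actY actB) (2 * D actN actB); last first.
  (* The seventh vertex with weight [6 * s] takes [3 * s] from the entry (Y, B) and [s] from (Y, A);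
     [AB] says exactly that [s] is available there. *)
  pose s := (D actY actB - 2 * D actN actB) / 3.
  apply: (comb (D actN actA - 2 * D actY actA) (3 * (D actY actA - s)) 0
    (3 * D actN actB) (3 * D actN actC) (D actY actC - 2 * D actN actC) (6 * s) 0);
    do ?split; rewrite /s; lra.
have [h2|h2] := leP (D actN actB) (2 * D actY actB); last first.
  pose s := (D actN actB - 2 * D actY actB) / 3.
  apply: (comb (D actN actA - 2 * D actY actA) (3 * D actY actA)
    (3 * D actY actB) 0 (3 * (D actN actC - s)) (D actY actC - 2 * D actN actC) 0 (6 * s));
    do ?split; rewrite /s; lra.
apply: (comb (D actN actA - 2 * D actY actA) (3 * D actY actA)
    (2 * D actN actB - D actY actB) (2 * D actY actB - D actN actB)
    (3 * D actN actC) (D actY actC - 2 * D actN actC) 0 0); do ?split; lra.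
Qed.

(** * Best responses in the example, and the vertices as profiles *)

Lemma payoff_pure (R : realType) (m n : nat) (u : 'M[R]_(m, n)) x j :
  payoff u x (pure R j) = \sum_(i < m) x 0 i * u i j.
Proof.
apply: eq_bigr => i _; rewrite (bigD1 j)//= big1 => [|k kj].
  by rewrite addr0 mxE !eqxx mulr1.
by rewrite mxE (negPf kj) andbF mulr0 mul0r.
Qed.

Lemma payoff_pure_sum (R : realType) (m n : nat) (u : 'M[R]_(m, n)) x y :
  payoff u x y = \sum_(j < n) y 0 j * payoff u x (pure R j).
Proof.
rewrite /payoff exchange_big; apply: eq_bigr => j _.
by rewrite -/(payoff u x _) payoff_pure mulr_sumr; apply: eq_bigr => i _; ring.
Qed.

(** Linear forms in an arbitrary vector, so that they also apply to unnormalised sums of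
    strategies. *)
Definition example_payoff (R : realType) (u : 'M[R]_(2, 3)) : Prop :=
  forall x, [/\ payoff u x (pure R actA) = 0,
    payoff u x (pure R actB) = (2 * x 0 actY - x 0 actN) / 6 &
    payoff u x (pure R actC) = (x 0 actY - x 0 actN) / 2].

Lemma payoffZ (R : realType) (m n : nat) (u : 'M[R]_(m, n)) (c : R) x y :
  payoff u (c *: x) y = c * payoff u x y.
Proof.
rewrite /payoff mulr_sumr; apply: eq_bigr => i _; rewrite mulr_sumr.
by apply: eq_bigr => j _; rewrite mxE; ring.
Qed.

Lemma BR_scale (R : realType) (m n : nat) (u : 'M[R]_(m, n)) (c : R) x b :
  0 < c -> BR u (c *: x) b <-> BR u x b.
Proof.
by move=> c0; split=> h k; have := h k; rewrite !payoffZ ler_pM2l.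
Qed.

Lemma mixE (R : realType) (p : R) : (mix p 0 actN = 1 - p) * (mix p 0 actY = p).
Proof. by rewrite !mxE. Qed.

Lemma mix_simplex (R : realType) (p : R) : 0 <= p <= 1 -> simplex (mix p).
Proof.
move=> /andP[p0 p1]; split; last by rewrite sum_optimizer !mixE subrK.
by elim/optimizer_ind; rewrite mixE ?subr_ge0.
Qed.

Lemma two_phase_profile (R : realType) (u : 'M[R]_(2, 3)) p1 b1 p2 b2 :
  0 <= p1 <= 1 -> 0 <= p2 <= 1 -> BR u (mix p1) b1 -> BR u (mix p1) b2 ->
  BR u (mix p1 + mix p2) b2 ->
  [set profile tau | tau in valid_traj u] (two_phase p1 b1 p2 b2).
Proof.
move=> p1P p2P B1 B2 B12; exists [:: (mix p1, 1, b1); (mix p2, 1, b2)].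
  split=> // -[|[|[|i]]] x t b //= [<- <- <-].
    split=> //; first exact: mix_simplex.
      (* Before the first step the mean is 0, to which every action is a best response. *)
      rewrite /traj_mean /= !big_nil scaler0 => k.
      by rewrite !payoff_pure !big1// => i _; rewrite mxE mul0r.
    by rewrite /traj_mean /= !big_seq1 /= invr1 !scale1r.
  split=> //; first exact: mix_simplex.
    by rewrite /traj_mean /= !big_seq1 /= invr1 !scale1r.
  rewrite /traj_mean /= !big_cons !big_nil /step_time /step_mix /= !addr0 !scale1r.
  by apply/BR_scale; rewrite ?invr_gt0// addr_gt0.
by rewrite /profile !big_cons !big_nil /step_time /step_mix /step_resp /= !addr0 !scale1r.
Qed.

Section Example.
Variables (R : realType) (u : 'M[R]_(2, 3)).
Hypothesis uE : example_payoff u.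

Lemma BR_A x : BR u x actA <->
  2 * x 0 actY <= x 0 actN /\ x 0 actY <= x 0 actN.
Proof.
have [eA eB eC] := uE x; split=> [h|[h1 h2]].
  by have := h actB; have := h actC; rewrite eA eB eC => ? ?; split; lra.
by elim/learner_ind; rewrite eA ?eB ?eC; lra.
Qed.

Lemma BR_B x : BR u x actB <->
  x 0 actN <= 2 * x 0 actY /\ x 0 actY <= 2 * x 0 actN.
Proof.
have [eA eB eC] := uE x; split=> [h|[h1 h2]].
  by have := h actA; have := h actC; rewrite eA eB eC => ? ?; split; lra.
by elim/learner_ind; rewrite eB ?eA ?eC; lra.
Qed.

Lemma BR_C x : BR u x actC <->
  x 0 actN <= x 0 actY /\ 2 * x 0 actN <= x 0 actY.
Proof.
have [eA eB eC] := uE x; split=> [h|[h1 h2]].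
  by have := h actA; have := h actB; rewrite eA eB eC => ? ?; split; lra.
by elim/learner_ind; rewrite eC ?eA ?eB; lra.
Qed.

Lemma vertices_profile p1 b1 p2 b2 : (p1, b1, p2, b2) \in vertices R ->
  [set profile tau | tau in valid_traj u] (two_phase p1 b1 p2 b2).
Proof.
have addE (x y : 'rV[R]_2) i j : (x + y) i j = x i j + y i j by rewrite mxE.
rewrite !inE; do 7?[case/orP]; move=> /eqP[-> -> -> ->];
  (apply: two_phase_profile; [lra|lra|..]);
  (first [apply/BR_A|apply/BR_B|apply/BR_C]); rewrite ?addE !mixE; split; lra.
Qed.

End Example.

(** * Profiles of valid trajectories lie in the polytope *)

Lemma prod_pureE (R : realType) (m n : nat) (x : 'rV[R]_m) (b : 'I_n) i j :
  prod_distr x (pure R b) i j = x 0 i * (j == b)%:R.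
Proof. by rewrite !mxE. Qed.

Lemma sum_prod_pure (R : realType) (m n : nat) (x : 'rV[R]_m) (b : 'I_n) i :
  \sum_(j < n) prod_distr x (pure R b) i j = x 0 i.
Proof.
rewrite (bigD1 b)//= big1 => [|j /negPf jb]; last by rewrite prod_pureE jb mulr0.
by rewrite prod_pureE eqxx mulr1 addr0.
Qed.

Lemma max0_pMr (R : realType) (c x : R) : 0 <= c -> Num.max 0 (c * x) = c * Num.max 0 x.
Proof. by move=> c0; rewrite maxr_pMr// mulr0. Qed.

Lemma advA_marginal (R : realType) (D : 'M[R]_(2, 3)) :
  advA D = (\sum_(j < 3) D actN j - 2 * \sum_(j < 3) D actY j) / 6.
Proof. by rewrite /advA !sum_learner; ring. Qed.

Lemma advC_marginal (R : realType) (D : 'M[R]_(2, 3)) :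
  advC D = (\sum_(j < 3) D actY j - 2 * \sum_(j < 3) D actN j) / 6.
Proof. by rewrite /advC !sum_learner; ring. Qed.

(** A response that is optimal at both ends of a step fixes the sign of each advantage at both ends,
    so each positive part changes linearly, either fully or not at all. *)
Lemma gain_step (R : realType) (b : 'I_3) (n y dn dy : R) :
  0 <= n -> 0 <= y -> 0 <= dn -> 0 <= dy ->
  [/\ if b == actA then 0 <= n - 2 * y else n - 2 * y <= 0 &
      if b == actC then 0 <= y - 2 * n else y - 2 * n <= 0] ->
  [/\ if b == actA then 0 <= n + dn - 2 * (y + dy) else n + dn - 2 * (y + dy) <= 0 &
      if b == actC then 0 <= y + dy - 2 * (n + dn) else y + dy - 2 * (n + dn) <= 0] ->
  Num.max 0 ((n - 2 * y) / 6) + (dn - 2 * dy) * (b == actA)%:R / 6 =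
    Num.max 0 ((n + dn - 2 * (y + dy)) / 6) /\
  Num.max 0 ((y - 2 * n) / 6) + (dy - 2 * dn) * (b == actC)%:R / 6 =
    Num.max 0 ((y + dy - 2 * (n + dn)) / 6).
Proof.
move=> n0 y0 dn0 dy0; rewrite /Num.max.
by elim/learner_ind: b => /= -[? ?] [? ?]; split; do 2?[case: ifP => ?]; lra.
Qed.

Section Example.
Variables (R : realType) (u : 'M[R]_(2, 3)).
Hypothesis uE : example_payoff u.

Lemma BR_adv x b : BR u x b -> 0 <= x 0 actN -> 0 <= x 0 actY ->
  [/\ if b == actA then 0 <= x 0 actN - 2 * x 0 actY else x 0 actN - 2 * x 0 actY <= 0 &
   if b == actC then 0 <= x 0 actY - 2 * x 0 actN else x 0 actY - 2 * x 0 actN <= 0].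
Proof.
by move=> + N0 Y0; elim/learner_ind: b => [/(BR_A uE)|/(BR_B uE)|/(BR_C uE)] [h1 h2] /=;
  split; lra.
Qed.

Let mass (s : seq (step R 2 3)) : 'M[R]_(2, 3) :=
  \sum_(r <- s) step_time r *: prod_distr (step_mix r) (pure R (step_resp r)).

(* Along a valid trajectory the learner plays A exactly while [advA >= 0], so
   [gainA] stays equal to the positive part of [advA]; similarly for C. *)
Lemma valid_prefix (tau : seq (step R 2 3)) (i : nat) : valid_traj u tau ->
  (i <= size tau)%N ->
  let X := \sum_(r <- take i tau) step_time r *: step_mix r in
  let W := \sum_(r <- take i tau) step_time r in
  let E := mass (take i tau) in
  [/\ forall k j, 0 <= E k j, forall k, \sum_(j < 3) E k j = X 0 k,
      X 0 actN + X 0 actY = W, ((0 < i)%N -> 0 < W) &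
      gainA E = Num.max 0 (advA E) /\ gainC E = Num.max 0 (advC E)].
Proof.
have addE (p q : nat) (x y : 'M[R]_(p, q)) k j : (x + y) k j = x k j + y k j by rewrite mxE.
have sclE (p q : nat) a (x : 'M[R]_(p, q)) k j : (a *: x) k j = a * x k j by rewrite mxE.
move=> [_ vtau]; elim: i => [_|i IH itau].
  rewrite take0 /mass !big_nil /advA /advC /gainA /gainC; split=> //.
  - by move=> k j; rewrite mxE.
  - by move=> k; rewrite mxE big1// => j _; rewrite mxE.
  - by rewrite !mxE addr0.
  - by rewrite !sum_learner !mxE !mulr0 !subr0 !mul0r !addr0 maxxx.
move/ltnW: (itau) => /IH {IH}.
case E : (onth tau i) => [[[x t] b]|]; last by move: itau; rewrite -onthTE E.
have [[x0 x1] t0 B0 B1] := vtau i x t b E; move: x1; rewrite sum_optimizer => x1.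
have sE : (step_time (x, t, b) = t) * (step_mix (x, t, b) = x) * (step_resp (x, t, b) = b) by [].
have nE : nth (x, t, b) tau i = (x, t, b) by exact: onth_nth E.
rewrite (take_nth (x, t, b))// nE /mass -cats1 !big_cat !big_seq1.
rewrite !sE.
move: B0 B1; rewrite /traj_mean (take_nth (x, t, b))// nE -cats1 !big_cat !big_seq1.
rewrite !sE /=.
set X := \sum_(_ <- _) _ *: step_mix _; set W := \sum_(_ <- _) step_time _.
rewrite -/(mass _); set D := mass _ => B0 B1 /= [D0 DX XW W0 [gA gC]].
have D0' k : 0 <= X 0 k by rewrite -DX sumr_ge0.
have Wt : 0 < W + t.
  by rewrite -XW ltr_wpDl// addr_ge0.
(* At the first step [W] is 0 and no rescaling is possible, but then [X] is an empty sum. *)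
have {}B0 : X = 0 \/ BR u X b.
  have [i0|/W0 i0] := posnP i; first by left; rewrite /X i0 take0 big_nil.
  right; have /(BR_scale u X b)[+ _] : 0 < W^-1 by rewrite invr_gt0.
  by apply.
have {}B1 : BR u (X + t *: x) b.
  have /(BR_scale u (X + t *: x) b)[+ _] : 0 < (W + t)^-1 by rewrite invr_gt0.
  by apply.
have xk k : 0 <= t * x 0 k by rewrite mulr_ge0// ltW.
have sg0 : [/\ if b == actA then 0 <= X 0 actN - 2 * X 0 actY else X 0 actN - 2 * X 0 actY <= 0
  & if b == actC then 0 <= X 0 actY - 2 * X 0 actN else X 0 actY - 2 * X 0 actN <= 0].
  case: B0 => [->|/BR_adv]; last exact.
  by rewrite !mxE mulr0 subrr; split; case: ifP.
have sg1 := BR_adv B1; rewrite !addE !sclE in sg1.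
have {}sg1 := sg1 (addr_ge0 (D0' _) (xk _)) (addr_ge0 (D0' _) (xk _)).
have DE k : \sum_(j < 3) (D + t *: prod_distr x (pure R b)) k j = X 0 k + t * x 0 k.
  under eq_bigr do rewrite addE sclE.
  by rewrite big_split/= -mulr_sumr sum_prod_pure DX.
split.
- by move=> k j; rewrite addE sclE prod_pureE addr_ge0 ?mulr_ge0// ltW.
- by move=> k; rewrite DE addE sclE.
- by rewrite !addE !sclE -XW -[in RHS](mulr1 t) -x1; ring.
- by [].
- rewrite advA_marginal advC_marginal !DE; move: gA gC; rewrite advA_marginal advC_marginal !DX.
  have [<- <-] := gain_step (D0' _) (D0' _) (xk _) (xk _) sg0 sg1 => <- <-.
  rewrite /gainA /gainC !addE !sclE !prod_pureE ![actA == _]eq_sym ![actC == _]eq_sym.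
  by split; ring.
Qed.

Lemma regret_polytope_profile tau : valid_traj u tau -> regret_polytope 0 (profile tau).
Proof.
move=> vtau; have [tau0 _] := vtau.
have := valid_prefix vtau (leqnn _); rewrite take_size.
have -> : (0 < size tau)%N by case: tau tau0 {vtau}.
rewrite /profile -/(mass tau); set X := \sum_(_ <- _) _; set W := \sum_(_ <- _) _.
move: (mass tau) => E /= [E0 EX XW /(_ isT) W0 [gA gC]].
have W1 : 0 <= W^-1 by rewrite invr_ge0 ltW.
have mA : advA (W^-1 *: E) = W^-1 * advA E.
  by rewrite /advA mulr_sumr; apply: eq_bigr => j _; rewrite !mxE; ring.
have mC : advC (W^-1 *: E) = W^-1 * advC E.
  by rewrite /advC mulr_sumr; apply: eq_bigr => j _; rewrite !mxE; ring.
have gmA : gainA (W^-1 *: E) = W^-1 * gainA E by rewrite /gainA !mxE; ring.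
have gmC : gainC (W^-1 *: E) = W^-1 * gainC E by rewrite /gainC !mxE; ring.
rewrite -(mulr0 30); apply: regret_polytope_gain.
- by move=> i j; rewrite mxE mulr_ge0.
- under eq_bigr do under eq_bigr do rewrite mxE.
  under eq_bigr do rewrite -mulr_sumr EX.
  by rewrite -mulr_sumr sum_optimizer XW mulVf// gt_eqF.
- by rewrite mA gmA gA max0_pMr// subr0.
- by rewrite mC gmC gC max0_pMr// subr0.
- by rewrite mA gmA mC gmC gA gC !max0_pMr// addr0.
Qed.

Lemma profile_hull : convex_hull [set profile tau | tau in valid_traj u] = regret_polytope 0.
Proof.
apply/seteqP; split.
  apply: convex_hull_min; first exact: regret_polytope_convex.
  by move=> _ [tau vtau <-]; exact: regret_polytope_profile.
apply: regret_polytope_sub; first exact: convex_hull_convex.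
by move=> p1 b1 p2 b2 /vertices_profile vP; apply: convex_hull_sub; exact: vP.
Qed.

End Example.

(** * Follow the regularized leader *)

Lemma pure_simplex (R : realType) (n : nat) (j : 'I_n) : simplex (pure R j).
Proof.
split=> [k|]; first by rewrite mxE ler0n.
rewrite (bigD1 j)//= big1 => [|k /negPf kj]; last by rewrite mxE kj andbF.
by rewrite mxE !eqxx addr0.
Qed.

Lemma simplex_convex (R : realType) (n : nat) : convex_subset (@simplex R n).
Proof.
move=> x y l [x0 x1] [y0 y1] /andP[l0 l1]; split=> [j|].
  by rewrite !mxE addr_ge0 ?mulr_ge0 ?subr_ge0.
under eq_bigr do rewrite !mxE.
by rewrite big_split/= -!mulr_sumr x1 y1; ring.
Qed.

Lemma payoff_comb (R : realType) (m n : nat) (u : 'M[R]_(m, n)) x y z (l : R) :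
  payoff u x (l *: y + (1 - l) *: z) = l * payoff u x y + (1 - l) * payoff u x z.
Proof.
rewrite /payoff !mulr_sumr -big_split; apply: eq_bigr => i _ /=.
by rewrite !mulr_sumr -big_split; apply: eq_bigr => j _ /=; rewrite !mxE; ring.
Qed.

Section FTRL.
Variables (R : realType) (m n : nat) (u : 'M[R]_(m, n)) (T : nat) (eta : R).
Variables (reg : 'rV[R]_n -> R) (AT : seq 'rV[R]_m -> 'rV[R]_n) (B mu : R).
Hypothesis eta0 : 0 < eta.
Hypothesis regB : forall y, simplex y -> `|reg y| <= B.
Hypothesis AT_FTRL : plays_FTRL u T eta reg AT.

(** The choice made after [h] is evaluated against [h] itself: by optimality it loses to a fixed
    action only the oscillation of the regularizer, at most [2 * B], over [eta]. *)
Lemma FTRL_regret h b : (size h < T)%N -> (forall x, x \in h -> simplex x) ->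
  \sum_(x <- h) payoff u x (pure R b) - \sum_(x <- h) payoff u x (AT h) <= 2 * B / eta.
Proof.
move=> hT hS; have [yS ymax] := AT_FTRL hT hS.
have := ymax _ (pure_simplex R b); rewrite /ftrl_objective.
have := regB (pure_simplex R b); have := regB yS; rewrite !ler_norml.
move=> /andP[r1 _] /andP[_ r2].
have : reg (pure R b) / eta <= B / eta by rewrite ler_pM2r ?invr_gt0.
have : - (B / eta) <= reg (AT h) / eta by rewrite -mulNr ler_pM2r ?invr_gt0.
lra.
Qed.

(** Each unit of weight off [b] costs at least [Delta] of cumulative payoff, and [FTRL_regret]
    bounds the total loss. *)
Lemma FTRL_best_response h b (Delta : R) :
  (size h < T)%N -> (forall x, x \in h -> simplex x) ->
  (forall k, k != b -> Delta <= \sum_(x <- h) payoff u x (pure R b) -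
     \sum_(x <- h) payoff u x (pure R k)) ->
  (1 - AT h 0 b) * Delta <= 2 * B / eta.
Proof.
move=> hT hS gap; apply: le_trans (FTRL_regret b hT hS).
have [[y0 y1] _] := AT_FTRL hT hS.
have -> : \sum_(x <- h) payoff u x (AT h) =
    \sum_(k < n) AT h 0 k * \sum_(x <- h) payoff u x (pure R k).
  under eq_bigr do rewrite payoff_pure_sum.
  by rewrite exchange_big; apply: eq_bigr => k _; rewrite mulr_sumr.
set U := fun k => \sum_(x <- h) payoff u x (pure R k).
have -> : U b - \sum_(k < n) AT h 0 k * U k = \sum_(k < n) AT h 0 k * (U b - U k).
  under [RHS]eq_bigr do rewrite mulrBr.
  by rewrite sumrB -mulr_suml y1 mul1r.
rewrite -[X in X - _]y1 [X in X - _](bigD1 b)//= addrAC subrr add0r mulr_suml.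
rewrite [leRHS](bigD1 b)//= subrr mulr0 add0r.
by apply: ler_sum => k kb; rewrite ler_wpM2l// gap.
Qed.

Hypothesis regC : forall (y z : 'rV[R]_n) (l : R), simplex y -> simplex z ->
  0 <= l <= 1 ->
  reg (l *: y + (1 - l) *: z) <= l * reg y + (1 - l) * reg z
    - mu / 2 * l * (1 - l) * \sum_(j < n) (y 0 j - z 0 j) ^+ 2.

(** The midpoint of the maximizer and [z] does not beat the maximizer, while strong convexity
    credits it with [mu / 8] times the squared distance; doubling gives [mu / 4]. *)
Lemma FTRL_strong_max h z : (size h < T)%N -> (forall x, x \in h -> simplex x) ->
  simplex z ->
  mu / (4 * eta) * \sum_(j < n) (AT h 0 j - z 0 j) ^+ 2 <=
  ftrl_objective u eta reg h (AT h) - ftrl_objective u eta reg h z.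
Proof.
move=> hT hS zS; have [yS ymax] := AT_FTRL hT hS.
have h01 : 0 <= (2^-1 : R) <= 1 by lra.
have := ymax _ (simplex_convex yS zS h01).
have := regC yS zS h01; set S := \sum_(j < n) _.
rewrite /ftrl_objective; under [X in _ -> X - _ <= _ -> _]eq_bigr do rewrite payoff_comb.
rewrite big_split/= -!mulr_sumr.
set r := reg (_ + _); move: (AT h) => y rE.
have : r / eta <= (2^-1 * reg y + (1 - 2^-1) * reg z - mu / 2 / 2 * (1 - 2^-1) * S) / eta.
  by rewrite ler_pM2r ?invr_gt0.
have -> : mu / (4 * eta) * S = mu / 4 * S / eta by field; rewrite gt_eqF.
lra.
Qed.

(** Adds [FTRL_strong_max] for [h] and for [rcons h x], each tested at the other's maximizer;
    everything cancels except the payoffs against [x]. The bound [T.-1] keeps the longer history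
    within the horizon. *)
Lemma FTRL_stability h x : (size h < T.-1)%N -> (forall z, z \in rcons h x -> simplex z) ->
  mu / (2 * eta) * \sum_(j < n) (AT (rcons h x) 0 j - AT h 0 j) ^+ 2 <=
  payoff u x (AT (rcons h x)) - payoff u x (AT h).
Proof.
move=> hT hS.
have hT1 : (size (rcons h x) < T)%N by rewrite size_rcons -ltn_predRL.
have hT0 : (size h < T)%N by rewrite (leq_trans hT)// leq_pred.
have hS0 z : z \in h -> simplex z by move=> zh; apply: hS; rewrite mem_rcons inE zh orbT.
have [yS _] := AT_FTRL hT0 hS0; have [zS _] := AT_FTRL hT1 hS.
have := FTRL_strong_max hT0 hS0 zS; have := FTRL_strong_max hT1 hS yS.
have -> : \sum_(j < n) (AT h 0 j - AT (rcons h x) 0 j) ^+ 2 =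
    \sum_(j < n) (AT (rcons h x) 0 j - AT h 0 j) ^+ 2.
  by apply: eq_bigr => j _; rewrite -sqrrN opprB.
rewrite /ftrl_objective -cats1 !big_cat /= !big_seq1.
set S := \sum_(j < n) _.
have -> : mu / (2 * eta) * S = 2 * (mu / (4 * eta) * S) by field; rewrite gt_eqF.
lra.
Qed.

End FTRL.

(** * The average play of FTRL in the example *)

Definition history_average (R : realType) (m n : nat) (X : nat -> 'rV[R]_m)
    (AT : seq 'rV[R]_m -> 'rV[R]_n) (T : nat) : 'M[R]_(m, n) :=
  T%:R^-1 *: \sum_(0 <= t < T) prod_distr (X t) (AT (mkseq X t)).

Lemma mkseq_rcons (T : Type) (X : nat -> T) t : mkseq X t.+1 = rcons (mkseq X t) (X t).
Proof. by rewrite /mkseq -addn1 iotaD map_cat cats1. Qed.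

Lemma max0_near (R : realType) (x d : R) : - (1 / 3) <= d -> d <= 1 / 3 ->
  Num.max 0 x - 1 / 3 <= Num.max 0 (x + d) <= Num.max 0 x + 1 / 3.
Proof. by move=> ? ?; rewrite /Num.max; do 2?[case: ifP => ?]; apply/andP; split; lra. Qed.

Section ExampleFTRL.
Variables (R : realType) (u : 'M[R]_(2, 3)) (n : nat) (eta : R).
Variables (reg : 'rV[R]_3 -> R) (AT : seq 'rV[R]_2 -> 'rV[R]_3) (B mu : R).
Hypothesis uE : example_payoff u.
Hypothesis eta0 : 0 < eta.
Hypothesis regB : forall y, simplex y -> `|reg y| <= B.
Hypothesis AT_FTRL : plays_FTRL u n.+1 eta reg AT.
Hypothesis mu0 : 0 < mu.
Hypothesis regC : forall (y z : 'rV[R]_3) (l : R), simplex y -> simplex z ->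
  0 <= l <= 1 ->
  reg (l *: y + (1 - l) *: z) <= l * reg y + (1 - l) * reg z
    - mu / 2 * l * (1 - l) * \sum_(j < 3) (y 0 j - z 0 j) ^+ 2.
Variable X : nat -> 'rV[R]_2.
Hypothesis XS : forall t, simplex (X t).

Let y t := AT (mkseq X t).
Let p t := y t 0 actA.
Let q t := y t 0 actC.
Let a t := (X t 0 actN - 2 * X t 0 actY) / 6.
Let c t := (X t 0 actY - 2 * X t 0 actN) / 6.
Let al t := \sum_(0 <= s < t) a s.
Let ga t := \sum_(0 <= s < t) c s.
(** The optimal regularized objective after [t] rounds less the cumulative payoff of B, as [PhiE]
    shows. *)
Let Phi t := al t * p t + ga t * q t - reg (y t) / eta.
Let G := 2 * B / eta.

Let mkseqS t x : x \in mkseq X t -> simplex x.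
Proof. by case/mapP => s _ ->. Qed.

Let yS t : (t <= n)%N -> simplex (y t).
Proof.
move=> tn; have sz : (size (mkseq X t) < n.+1)%N by rewrite size_mkseq.
by have [] := AT_FTRL sz (@mkseqS t).
Qed.

Let XE t : [/\ 0 <= X t 0 actN, 0 <= X t 0 actY & X t 0 actN + X t 0 actY = 1].
Proof. by have [X0] := XS t; rewrite sum_optimizer. Qed.

Let payoffE x z : simplex z -> payoff u x z = payoff u x (pure R actB) +
  (x 0 actN - 2 * x 0 actY) / 6 * z 0 actA + (x 0 actY - 2 * x 0 actN) / 6 * z 0 actC.
Proof.
move=> [_]; rewrite sum_learner payoff_pure_sum sum_learner => z1.
have [-> -> ->] := uE x; have -> : z 0 actB = 1 - z 0 actA - z 0 actC by rewrite -z1; ring.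
by field.
Qed.

Let objE t z : simplex z -> ftrl_objective u eta reg (mkseq X t) z =
  \sum_(x <- mkseq X t) payoff u x (pure R actB) + al t * z 0 actA + ga t * z 0 actC
  - reg z / eta.
Proof.
move=> zS; congr (_ - _); rewrite /al /ga !big_map /index_iota !subn0 !mulr_suml -!big_split.
by apply: eq_bigr => s _; rewrite payoffE.
Qed.

Let B0 : 0 <= B.
Proof. exact: le_trans (normr_ge0 _) (regB (pure_simplex R actA)). Qed.

Let PhiE t : (t <= n)%N -> Phi t = ftrl_objective u eta reg (mkseq X t) (y t) -
  \sum_(x <- mkseq X t) payoff u x (pure R actB).
Proof. by move=> /yS tn; rewrite objE// /Phi /p /q; ring. Qed.

Let Phi_max t z : (t <= n)%N -> simplex z ->
  al t * z 0 actA + ga t * z 0 actC - reg z / eta <= Phi t.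
Proof.
move=> tn zS; have sz : (size (mkseq X t) < n.+1)%N by rewrite size_mkseq.
have [_] := AT_FTRL sz (@mkseqS t).
by move=> /(_ z zS); rewrite PhiE// (objE t zS); lra.
Qed.

Let reg_bound z : simplex z -> - (B / eta) <= reg z / eta <= B / eta.
Proof.
move=> /regB; rewrite ler_norml => /andP[? ?].
by rewrite -mulNr !ler_pM2r ?invr_gt0//; apply/andP.
Qed.

Let Ge : G = B / eta + B / eta. Proof. by rewrite /G; ring. Qed.

Let yE t : (t <= n)%N -> [/\ 0 <= p t, 0 <= q t & p t + q t <= 1].
Proof.
move=> /yS[y0]; rewrite sum_learner => y1; split; rewrite ?y0//.
by rewrite /p /q -y1 addrAC lerDl.
Qed.

Let Phi_bound t : (t <= n)%N -> [/\ - (B / eta) <= Phi t, al t - B / eta <= Phi t,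
  ga t - B / eta <= Phi t &
  forall z : R, 0 <= z -> al t <= z -> ga t <= z -> Phi t <= z + B / eta].
Proof.
move=> tn; have P j := Phi_max tn (pure_simplex R j); have Q j := reg_bound (pure_simplex R j).
have e1 j : pure R j 0 actA = (actA == j)%:R by rewrite mxE.
have e2 j : pure R j 0 actC = (actC == j)%:R by rewrite mxE.
split.
- by have := P actB; have /andP[] := Q actB; rewrite e1 e2 /=; lra.
- by have := P actA; have /andP[] := Q actA; rewrite e1 e2 /=; lra.
- by have := P actC; have /andP[] := Q actC; rewrite e1 e2 /=; lra.
move=> z z0 az gz; have [p0 q0 pq] := yE tn; have /andP[r1 r2] := reg_bound (yS tn).
rewrite /Phi; have : 0 <= p t * (z - al t) by rewrite mulr_ge0 ?subr_ge0.
have : 0 <= q t * (z - ga t) by rewrite mulr_ge0 ?subr_ge0.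
have : 0 <= (1 - p t - q t) * z by rewrite mulr_ge0//; lra.
lra.
Qed.

(** Testing [y t.+1] at time [t] bounds the increment of [Phi] by the payoff of the new choice. It
    exceeds that of the old one by [v], and stability gives [mu / (2 * eta) * v ^+ 2 <= v]. *)
Let Phi_lower t : (t < n)%N -> Phi t.+1 - Phi t - 2 * eta / mu <= p t * a t + q t * c t.
Proof.
move=> tn; have [N0 Y0 NY] := XE t.
have sz : (size (mkseq X t) < n.+1.-1)%N by rewrite size_mkseq.
have hS z : z \in rcons (mkseq X t) (X t) -> simplex z.
  by rewrite -mkseq_rcons; exact: mkseqS.
have : mu / (2 * eta) * \sum_(j < 3) (y t.+1 0 j - y t 0 j) ^+ 2 <=
    payoff u (X t) (y t.+1) - payoff u (X t) (y t).
  by have := FTRL_stability eta0 AT_FTRL regC sz hS; rewrite -mkseq_rcons.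
have y1S := yS tn; have y0S := yS (ltnW tn).
have pE z : simplex z -> payoff u (X t) z =
    payoff u (X t) (pure R actB) + a t * z 0 actA + c t * z 0 actC.
  exact: payoffE.
rewrite (pE _ y1S) (pE _ y0S) sum_learner => stab.
have alS : al t.+1 = al t + a t by rewrite /al big_nat_recr.
have gaS : ga t.+1 = ga t + c t by rewrite /ga big_nat_recr.
have step : Phi t.+1 <= Phi t + a t * p t.+1 + c t * q t.+1.
  by have := Phi_max (ltnW tn) y1S; rewrite /Phi alS gaS /p /q; lra.
pose v := a t * (p t.+1 - p t) + c t * (q t.+1 - q t).
have v2 : mu / (2 * eta) * v ^+ 2 <= v.
  have -> : v = a t * y t.+1 0 actA + c t * y t.+1 0 actC - (a t * y t 0 actA + c t * y t 0 actC).
    by rewrite /v /p /q; ring.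
  apply: le_trans (_ : _ <= mu / (2 * eta) * _) _; last first.
    apply: le_trans stab _; lra.
  rewrite ler_pM2l ?divr_gt0 ?mulr_gt0//.
  move: N0 Y0 NY; rewrite /v /p /q /a /c.
  move: (y t) (y t.+1) (X t) => y0 y1 x N0 Y0 NY.
  have c1 : ((x 0 actN - 2 * x 0 actY) / 6) ^+ 2 + ((x 0 actY - 2 * x 0 actN) / 6) ^+ 2 <= 1.
    have -> : x 0 actN = 1 - x 0 actY by lra.
    nra.
  (* The square that is the defect in the Cauchy-Schwarz inequality for [v], whose coefficients have
     squares summing to at most 1 by [c1]. *)
  have := sqr_ge0 ((x 0 actN - 2 * x 0 actY) / 6 * (y1 0 actC - y0 0 actC) -
    (x 0 actY - 2 * x 0 actN) / 6 * (y1 0 actA - y0 0 actA)).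
  have := sqr_ge0 (y1 0 actB - y0 0 actB).
  have : 0 <= (1 - (((x 0 actN - 2 * x 0 actY) / 6) ^+ 2 + ((x 0 actY - 2 * x 0 actN) / 6) ^+ 2)) *
     ((y1 0 actA - y0 0 actA) ^+ 2 + (y1 0 actC - y0 0 actC) ^+ 2).
    by rewrite mulr_ge0 ?subr_ge0// addr_ge0 ?sqr_ge0.
  move: ((x 0 actN - 2 * x 0 actY) / 6) ((x 0 actY - 2 * x 0 actN) / 6) => a' c'.
  lra.
have gen (w : R) : mu / (2 * eta) * w ^+ 2 <= w -> w <= 2 * eta / mu.
  move=> w2; have [w0|w0] := leP w 0.
    by rewrite (le_trans w0)// divr_ge0 ?mulr_ge0// ltW.
  have : mu / (2 * eta) * w <= 1.
    by rewrite -(ler_pM2r w0) mul1r; apply: le_trans w2; rewrite expr2 mulrA.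
  rewrite ler_pdivlMr// => h; have : mu / (2 * eta) * w * (2 * eta) <= 1 * (2 * eta).
    by rewrite ler_pM2r// mulr_gt0.
  have -> : mu / (2 * eta) * w * (2 * eta) = w * mu by field; rewrite gt_eqF.
  lra.
have vle := gen _ v2.
rewrite /v in vle; lra.
Qed.

Let Phi_upper t : (t < n)%N -> p t * a t + q t * c t <= Phi t.+1 - Phi t.
Proof.
move=> tn; have alS : al t.+1 = al t + a t by rewrite /al big_nat_recr.
have gaS : ga t.+1 = ga t + c t by rewrite /ga big_nat_recr.
by have := Phi_max tn (yS (ltnW tn)); rewrite /Phi alS gaS /p /q; lra.
Qed.

Let acE t : [/\ `|a t| <= 1 / 3, `|c t| <= 1 / 3 & a t + c t = - (1 / 6)].
Proof.
by have [N0 Y0 NY] := XE t; rewrite !ler_norml /a /c; split; try (apply/andP; split); lra.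
Qed.

Let al_ga t : al t + ga t = - t%:R / 6.
Proof.
rewrite /al /ga -big_split/= (eq_bigr (fun=> - (1 / 6))) => [|s _]; last by have [] := acE s.
by rewrite big_const_nat iter_addr subn0 addr0 mulNr -mulr_natl; field.
Qed.

(** [Phi t] is at least [max 0 (ga t) - B / eta], and its part [ga t * q t] is at most
    [max 0 (ga t)]; so [al t * p t] cannot be below [- 2 B / eta]. Likewise with A and C
    exchanged. *)
Let pq_small t : (t <= n)%N -> - p t * al t <= G /\ - q t * ga t <= G.
Proof.
move=> tn; have [P1 P2 P3 _] := Phi_bound tn; have [p0 q0 pq] := yE tn.
have /andP[r1 r2] := reg_bound (yS tn); rewrite Ge.
move: P1 P2 P3; rewrite /Phi => P1 P2 P3; split.
  have [g0|g0] := leP (ga t) 0.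
    by have : 0 <= q t * - ga t by [rewrite mulr_ge0// oppr_ge0]; lra.
  have : 0 <= (1 - q t) * ga t by apply: mulr_ge0; lra.
  lra.
have [g0|g0] := leP (al t) 0.
  by have : 0 <= p t * - al t by [rewrite mulr_ge0// oppr_ge0]; lra.
have : 0 <= (1 - p t) * al t by apply: mulr_ge0; lra.
lra.
Qed.

Let G0 : 0 <= B / eta. Proof. by rewrite divr_ge0// ltW. Qed.

Let lower (D : R) (M : nat) : 1 <= D -> 24 * D <= M%:R ->
  Num.max 0 (al n) - 2 * G - n%:R * (2 * eta / mu + 3 * G / D) - 2 * M%:R <=
    \sum_(0 <= t < n) p t * a t /\
  Num.max 0 (ga n) - 2 * G - n%:R * (2 * eta / mu + 3 * G / D) - 2 * M%:R <=
    \sum_(0 <= t < n) q t * c t.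
Proof.
move=> D1 DM; have k0 : 0 <= 2 * eta / mu by rewrite divr_ge0 ?mulr_ge0// ltW.
have G1 := G0; have G0' : 0 <= G by rewrite Ge addr_ge0.
have alS t : al t.+1 = al t + a t by rewrite /al big_nat_recr.
have gaS t : ga t.+1 = ga t + c t by rewrite /ga big_nat_recr.
have al0 : al 0%N = 0 by rewrite /al big_geq.
have ga0 : ga 0%N = 0 by rewrite /ga big_geq.
split.
  apply: (half_regret (Phi := Phi) (q := q) (c := c) D1 DM G0' k0 al0 ga0) => t tn.
  - exact: al_ga.
  - by have [? ? _] := acE t; split=> //; exact: Phi_lower.
  - by have [? ? ?] := yE tn; have [? ?] := pq_small tn.
  - have [P1 P2 P3 P4] := Phi_bound tn; split; rewrite ?Ge; [lra|lra|].
    by move=> z z0 az gz; have := P4 z z0 az gz; lra.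
apply: (half_regret (Phi := Phi) (q := p) (c := a) D1 DM G0' k0 ga0 al0) => t tn.
- by rewrite addrC; exact: al_ga.
- have [? ? _] := acE t; split=> //; rewrite [_ + p t * _]addrC; exact: Phi_lower.
- by have [? ? ?] := yE tn; have [? ?] := pq_small tn; rewrite addrC.
- have [P1 P2 P3 P4] := Phi_bound tn; split; rewrite ?Ge; [lra|lra|].
  by move=> z z0 az gz; have := P4 z z0 gz az; lra.
Qed.

Let upper : \sum_(0 <= t < n) p t * a t + \sum_(0 <= t < n) q t * c t <=
  Num.max 0 (al n) + Num.max 0 (ga n) + G.
Proof.
rewrite -big_split/=; apply: (@le_trans _ _ (Phi n - Phi 0%N)).
  rewrite -(telescope_sumr Phi (leq0n n)) !big_nat.
  by apply: ler_sum => t /andP[_]; exact: Phi_upper.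
have [_ _ _ P4] := Phi_bound (leqnn n); have [P1 _ _ _] := Phi_bound (leq0n n).
have m1 : 0 <= Num.max 0 (al n) by rewrite le_max lexx.
have m2 : 0 <= Num.max 0 (ga n) by rewrite le_max lexx.
have m3 : al n <= Num.max 0 (al n) by rewrite le_max lexx orbT.
have m4 : ga n <= Num.max 0 (ga n) by rewrite le_max lexx orbT.
have := P4 (Num.max 0 (al n) + Num.max 0 (ga n)) (addr_ge0 m1 m2).
rewrite Ge => /(_ _ _) P; have {}P := P (le_trans m3 _) (le_trans m4 _).
have {}P := P (ler_wpDr m2 (lexx _)) (ler_wpDl m1 (lexx _)).
lra.
Qed.

(** Feeds [lower] and [upper] into [regret_polytope_gain]. The summand 2 absorbs round [n], which
    has no successor for the stability estimate: each positive part and each gain moves there by at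
    most 1/3. *)
Lemma FTRL_average_polytope (D : R) (M : nat) : 1 <= D -> 24 * D <= M%:R ->
  regret_polytope
    (30 * ((2 * G + n%:R * (2 * eta / mu + 3 * G / D) + 2 * M%:R + 2) / n.+1%:R))
    (history_average X AT n.+1).
Proof.
move=> D1 DM; have [lA lC] := lower D1 DM; have up := upper.
set E := history_average _ _ _.
have T0 : 0 < n.+1%:R^-1 :> R by rewrite invr_gt0.
have EE i j : E i j = n.+1%:R^-1 * \sum_(0 <= t < n.+1) X t 0 i * y t 0 j.
  by rewrite mxE summxE; congr (_ * _); apply: eq_bigr => t _; rewrite mxE.
have Em i : \sum_(j < 3) E i j = n.+1%:R^-1 * \sum_(0 <= t < n.+1) X t 0 i.
  under eq_bigr do rewrite EE; rewrite -mulr_sumr exchange_big/=; congr (_ * _).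
  rewrite !big_nat; apply: eq_bigr => t /andP[_ tn].
  by have [_ y1] := yS tn; rewrite -mulr_sumr y1 mulr1.
have aE : advA E = n.+1%:R^-1 * al n.+1.
  rewrite advA_marginal !Em /al /a -mulr_suml sumrB -mulr_sumr; ring.
have cE : advC E = n.+1%:R^-1 * ga n.+1.
  rewrite advC_marginal !Em /ga /c -mulr_suml sumrB -mulr_sumr; ring.
have gA : gainA E = n.+1%:R^-1 * \sum_(0 <= t < n.+1) p t * a t.
  rewrite /gainA !EE mulrCA -mulrBr -mulrA; congr (_ * _).
  by rewrite mulr_sumr -sumrB mulr_suml; apply: eq_bigr => t _; rewrite /p /a; ring.
have gC : gainC E = n.+1%:R^-1 * \sum_(0 <= t < n.+1) q t * c t.
  rewrite /gainC !EE mulrCA -mulrBr -mulrA; congr (_ * _).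
  by rewrite mulr_sumr -sumrB mulr_suml; apply: eq_bigr => t _; rewrite /q /c; ring.
have [p0 q0 pq] := yE (leqnn n); have [an cn _] := acE n.
have bd (x z : R) : 0 <= x -> x <= 1 -> `|z| <= 1 / 3 -> `|x * z| <= 1 / 3.
  by move=> x0 x1; apply: le_trans; rewrite normrM (ger0_norm x0) ler_piMl.
have pan : `|p n * a n| <= 1 / 3 by apply: bd => //; lra.
have qcn : `|q n * c n| <= 1 / 3 by apply: bd => //; lra.
move: an cn pan qcn; rewrite !ler_norml.
move=> /andP[an1 an2] /andP[cn1 cn2] /andP[pan1 pan2] /andP[qcn1 qcn2].
have alS : al n.+1 = al n + a n by rewrite /al big_nat_recr.
have gaS : ga n.+1 = ga n + c n by rewrite /ga big_nat_recr.
have G1 := G0; have G0' : 0 <= G by rewrite Ge addr_ge0.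
have /andP[lal1 lal2] := max0_near (al n) an1 an2; have /andP[lga1 lga2] := max0_near (ga n) cn1 cn2.
rewrite -alS in lal1 lal2; rewrite -gaS in lga1 lga2.
have k0 : 0 <= n%:R * (2 * eta / mu + 3 * G / D).
  have ? : 0 <= 2 * eta / mu by rewrite divr_ge0 ?mulr_ge0// ltW.
  have D0 : 0 <= D by lra.
  by rewrite mulr_ge0// addr_ge0// divr_ge0// mulr_ge0.
have M0 : 0 <= M%:R :> R by rewrite ler0n.
apply: regret_polytope_gain.
- move=> i j; rewrite EE mulr_ge0 ?(ltW T0)// big_nat sumr_ge0// => t /andP[_ tn].
  by have [x0 _] := XS t; have [y0 _] := yS tn; rewrite mulr_ge0.
- under eq_bigr do rewrite Em.
  rewrite -mulr_sumr exchange_big/= (eq_bigr (fun=> 1)) => [|t _]; last by have [] := XS t.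
  by rewrite big_const_nat iter_addr subn0 addr0 mulVf// pnatr_eq0.
- rewrite aE gA (max0_pMr _ (ltW T0)) [_ / _]mulrC -mulrBr ler_pM2l// big_nat_recr//=; lra.
- rewrite cE gC (max0_pMr _ (ltW T0)) [_ / _]mulrC -mulrBr ler_pM2l// big_nat_recr//=; lra.
- rewrite aE gA cE gC !(max0_pMr _ (ltW T0)) [_ / _]mulrC -!mulrDr ler_pM2l//.
  by rewrite !big_nat_recr//=; lra.
Qed.

End ExampleFTRL.

(** * Approaching the vertices *)

Definition phase_play (R : realType) (p1 p2 : R) (k t : nat) : 'rV[R]_2 :=
  if (t < k)%N then mix p1 else mix p2.

Definition margin (R : realType) (u : 'M[R]_(2, 3)) (p : R) (b j : 'I_3) : R :=
  payoff u (mix p) (pure R b) - payoff u (mix p) (pure R j).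

Lemma margin_phase_play (R : realType) (u : 'M[R]_(2, 3)) (p1 p2 : R) (k t : nat) b j :
  \sum_(x <- mkseq (phase_play p1 p2 k) t) payoff u x (pure R b) -
  \sum_(x <- mkseq (phase_play p1 p2 k) t) payoff u x (pure R j) =
  (minn t k)%:R * margin u p1 b j + (t - k)%:R * margin u p2 b j.
Proof.
have succ l : l.+1%:R = l%:R + 1 :> R by rewrite -addn1 natrD.
elim: t => [|t IH]; first by rewrite !big_nil min0n sub0n !mul0r addr0 subrr.
rewrite mkseq_rcons -cats1 !big_cat !big_seq1/= {2 4}/phase_play.
rewrite opprD addrACA IH; have [tk|kt] := ltnP t k.
  have kt : (t <= k)%N by exact: ltnW.
  have e0 : (t.+1 - k = 0)%N by apply/eqP.
  have e1 : (t - k = 0)%N by apply/eqP.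
  rewrite (minn_idPl tk) e0 e1 succ /margin; ring.
have e1 : minn t.+1 k = k by apply/minn_idPr/leqW.
rewrite e1 subSn// succ /margin; ring.
Qed.

Lemma sum_window (a M T : nat) : (\sum_(0 <= t < T) (a <= t < a + M) <= M)%N.
Proof.
(* The exact count goes through the induction, which the bound alone would not. *)
suff -> : (\sum_(0 <= t < T) (a <= t < a + M) = minn (T - a) M)%N by rewrite geq_minr.
by elim: T => [|T IH]; [rewrite big_geq|rewrite big_nat_recr//= IH]; lia.
Qed.

Section TwoPhase.
Variables (R : realType) (u : 'M[R]_(2, 3)) (T : nat) (eta : R).
Variables (reg : 'rV[R]_3 -> R) (AT : seq 'rV[R]_2 -> 'rV[R]_3) (B : R).
Hypothesis eta0 : 0 < eta.
Hypothesis regB : forall y, simplex y -> `|reg y| <= B.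
Hypothesis AT_FTRL : plays_FTRL u T eta reg AT.
Hypothesis T0 : (0 < T)%N.

(** Outside the first [M] rounds of each phase the intended response leads by [Delta], so
    [FTRL_best_response] applies. The [2 * M] excluded rounds are estimated trivially, and the extra
    1 covers the unequal phases of an odd horizon. *)
Lemma FTRL_two_phase (p1 p2 : R) (b1 b2 : 'I_3) (M : nat) (Delta : R) :
  0 <= p1 <= 1 -> 0 <= p2 <= 1 -> 0 < Delta ->
  (forall j, j != b1 -> Delta <= M%:R * margin u p1 b1 j) ->
  (forall j, j != b2 ->
     Delta <= (T./2)%:R * margin u p1 b2 j + M%:R * margin u p2 b2 j) ->
  (forall j, j != b2 ->
     Delta <= (T./2)%:R * margin u p1 b2 j + (T./2)%:R * margin u p2 b2 j) ->
  forall i j, `|history_average (phase_play p1 p2 T./2) AT T i j -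
    two_phase p1 b1 p2 b2 i j| <= 2 * B / eta / Delta + (2 * M%:R + 1) / T%:R.
Proof.
move=> p1P p2P Delta0 gap1 gap2 gap2' i j.
set k := T./2; set X := phase_play p1 p2 k.
have XS t : simplex (X t) by rewrite /X /phase_play; case: ifP => _; exact: mix_simplex.
pose y t := AT (mkseq X t); pose b t := if (t < k)%N then b1 else b2.
have mS t x : x \in mkseq X t -> simplex x by case/mapP => s _ ->.
have yS t : (t < T)%N -> simplex (y t).
  by move=> tT; have [] := AT_FTRL (h := mkseq X t); rewrite ?size_mkseq//; exact: mS.
have B0 : 0 <= B by apply: le_trans (regB (pure_simplex R actA)).
have G0 : 0 <= 2 * B / eta / Delta.
  by rewrite !divr_ge0 ?mulr_ge0// ltW.
have y_near t : (t < T)%N ->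
    1 - y t 0 (b t) <= 2 * B / eta / Delta + (t < M)%:R + (k <= t < k + M)%N%:R.
  move=> tT; have [y0 y1] := yS t tT.
  have y0b : 1 - y t 0 (b t) <= 1 by rewrite lerBlDr lerDl.
  have [tM|Mt] := ltnP t M; first by rewrite (le_trans y0b)// addrAC lerDr addr_ge0.
  have [//|kt] := boolP (k <= t < k + M)%N; first by rewrite (le_trans y0b)// lerDr addr_ge0.
  rewrite !addr0 ler_pdivlMr//.
  apply: (FTRL_best_response eta0 regB AT_FTRL); rewrite ?size_mkseq//; first exact: mS.
  move=> l lb; rewrite margin_phase_play; move: lb; rewrite /b.
  have [tk|tk] := ltnP t k => lb.
    have -> : (t - k = 0)%N by apply/eqP; exact: ltnW.
    rewrite mul0r addr0 (le_trans (gap1 _ lb))//.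
    rewrite ler_wpM2r ?ler_nat//.
    have := lt_le_trans Delta0 (gap1 _ lb).
    by have [//|m0] := leP 0 (margin u p1 b1 l); have := ler0n R M; nra.
  have Mtk : (M <= t - k)%N by move: kt; rewrite tk/= -leqNgt leq_subRL.
  have tkk : (t - k <= k)%N.
    rewrite leq_subLR -ltnS (leq_trans tT)// -[leqLHS]odd_double_half -/k -addnn.
    by case: (odd T); rewrite ?add0n// add1n.
  (* In the second phase the lead is affine in [t - k], which lies between [M] and [k]; the sign of
     its slope tells which end to compare with. *)
  have [m0|m0] := leP 0 (margin u p2 b2 l).
    by rewrite (le_trans (gap2 _ lb))// lerD2l ler_wpM2r// ler_nat.
  by rewrite (le_trans (gap2' _ lb))// lerD2l ler_wnM2r ?ler_nat// ltW.
have TR0 : 0 < T%:R :> R by rewrite ltr0n.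
pose f1 := mix p1 0 i * (j == b1)%:R; pose f2 := mix p2 0 i * (j == b2)%:R.
have mix01 (p : R) : 0 <= p <= 1 -> 0 <= mix p 0 i <= 1.
  by move=> /andP[? ?]; rewrite mxE; case: ifP => _; apply/andP; split; lra.
have f01 (p : R) b' : 0 <= p <= 1 -> 0 <= mix p 0 i * (j == b')%:R <= 1.
  by move=> /mix01 /andP[? ?]; case: (j == b'); rewrite ?mulr1 ?mulr0 ?lexx ?ler01//; apply/andP.
have kT : (k <= T)%N by rewrite /k -[leqRHS]odd_double_half -addnn addnA leq_addl.
have sumF : \sum_(0 <= t < T) X t 0 i * (j == b t)%:R = k%:R * f1 + (T%:R - k%:R) * f2.
  rewrite (big_cat_nat (leq0n k) kT)/= -natrB//; congr (_ + _).
    rewrite big_nat (eq_bigr (fun=> f1)) => [|t /andP[_ tk]]; last by rewrite /X /phase_play /b tk.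
    by rewrite -big_nat big_const_nat iter_addr subn0 addr0 mulr_natl.
  rewrite big_nat (eq_bigr (fun=> f2)) => [|t /andP[tk _]].
    by rewrite -big_nat big_const_nat iter_addr addr0 mulr_natl.
  by rewrite /X /phase_play /b ltnNge tk.
have close : `|\sum_(0 <= t < T) X t 0 i * y t 0 j - \sum_(0 <= t < T) X t 0 i * (j == b t)%:R|
    <= T%:R * (2 * B / eta / Delta) + 2 * M%:R.
  rewrite -sumrB; apply: le_trans (ler_norm_sum _ _ _) _.
  apply: (@le_trans _ _ (\sum_(0 <= t < T)
      (2 * B / eta / Delta + (0 <= t < 0 + M)%N%:R + (k <= t < k + M)%N%:R))).
    rewrite !big_nat; apply: ler_sum => t /andP[_ tT]; apply: le_trans (y_near t tT).
    have [y0 y1] := yS t tT.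
    have /andP[x0 x1] : 0 <= X t 0 i <= 1.
      by rewrite /X /phase_play; case: ifP => _; exact: mix01.
    rewrite -mulrBr normrM (ger0_norm x0).
    apply: (@le_trans _ _ `|y t 0 j - (j == b t)%:R|); first by rewrite ler_piMl.
    have [->|jb] := eqVneq j (b t); last first.
      rewrite subr0 ger0_norm ?y0// -y1 (bigD1 (b t))//= addrAC subrr add0r.
      by rewrite (bigD1 j)//= lerDl sumr_ge0.
    rewrite distrC ger0_norm// subr_ge0 -y1 (bigD1 (b t))//= lerDl sumr_ge0//.
  rewrite !big_split/= -!natr_sum big_const_nat iter_addr subn0 addr0 -[_ *+ T]mulr_natl.
  have h0 := sum_window 0 M T; have h1 := sum_window k M T.
  rewrite -addrA lerD2l (_ : 2 * M%:R = M%:R + M%:R); last by ring.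
  by rewrite lerD// ler_nat.
rewrite two_phaseE /history_average mxE summxE.
under eq_bigr do rewrite mxE.
rewrite -/f1 -/f2; move: close; rewrite sumF.
set S := \sum_(0 <= t < T) _ => close.
have -> : ((if i == actN then 1 - p1 else p1) * (j == b1)%:R +
    (if i == actN then 1 - p2 else p2) * (j == b2)%:R) = f1 + f2.
  by rewrite /f1 /f2 !mxE.
have -> : T%:R^-1 * S - (f1 + f2) / 2 = (S - (k%:R * f1 + (T%:R - k%:R) * f2)) / T%:R +
    (k%:R - T%:R / 2) * (f1 - f2) / T%:R.
  by field; rewrite gt_eqF.
apply: le_trans (ler_normD _ _) _.
rewrite [2 * B / eta / Delta](_ : _ = T%:R * (2 * B / eta / Delta) / T%:R); last first.
  by rewrite [RHS]mulrC mulKf// gt_eqF.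
rewrite !normrM !(gtr0_norm (_ : 0 < T%:R^-1)) ?invr_gt0// -!mulrDl ler_pM2r ?invr_gt0//.
rewrite addrA lerD// -[leRHS]mulr1 ler_pM//.
  have -> : T%:R = (odd T)%:R + 2 * k%:R :> R by rewrite -natrM -natrD mul2n odd_double_half.
  by rewrite ler_norml; case: (odd T) => /=; apply/andP; split; lra.
have /andP[a1 a2] := f01 p1 b1 p1P; have /andP[a3 a4] := f01 p2 b2 p2P.
by rewrite ler_norml; apply/andP; split; rewrite /f1 /f2; lra.
Qed.

End TwoPhase.

(** * Average plays as sequences, and Hausdorff distance *)

Lemma average_playE (R : realType) (m n : nat) (A : learning_algorithm R m n) (T : nat)
    (x : T.-tuple 'rV[R]_m) (X : nat -> 'rV[R]_m) :
  (forall t : 'I_T, tnth x t = X t) -> average_play A x = history_average X (A T) T.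
Proof.
move=> xX; rewrite /average_play /history_average big_mkord.
congr (_ *: _); apply: eq_bigr => t _; rewrite xX; congr (prod_distr _ (A T _)).
apply: (@eq_from_nth _ 0) => [|s]; rewrite size_take size_tuple ltn_ord ?size_mkseq// => st.
by rewrite nth_take// nth_mkseq// -(xX (Ordinal (ltn_trans st (ltn_ord t)))) (tnth_nth 0).
Qed.

(** Nonemptiness of [S] serves the lower bound, a supremum over the empty set being minus
    infinity. *)
Lemma hausdorff_dist_le (R : realType) (X : pseudoMetricType R) (S S' : set X) (e : R) :
  0 < e -> S !=set0 ->
  (forall x, S x -> exists2 y, S' y & ball x e y) ->
  (forall y, S' y -> exists2 x, S x & ball y e x) ->
  (0 <= hausdorff_dist S S' <= e%:E)%E.
Proof.
move=> e0 [x0 Sx0] SS' S'S; apply/andP; split.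
  rewrite /hausdorff_dist le_max; apply/orP; left.
  apply: le_ereal_sup_tmp; exists (edist_inf S' x0); first by exists x0.
  exact: edist_inf_ge0.
rewrite /hausdorff_dist ge_max; apply/andP; split; apply: ge_ereal_sup => _ [x Sx <-].
  have [y Sy xy] := SS' x Sx; apply: le_trans (_ : edist (x, y) <= _)%E.
    by apply: ereal_inf_lbound; exists y.
  exact: edist_fin.
have [y Sy xy] := S'S x Sx; apply: le_trans (_ : edist (x, y) <= _)%E.
  by apply: ereal_inf_lbound; exists y.
exact: edist_fin.
Qed.

Lemma ball_mx_norm (R : realType) (m n : nat) (x y : 'M[R]_(m, n)) (e : R) :
  0 < e -> (forall i j, `|x i j - y i j| < e) -> ball x e y.
Proof. by move=> e0 xy; split. Qed.

Lemma two_phase_lipschitz (R : realType) (p1 p2 q1 q2 d : R) b1 b2 i j :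
  `|p1 - q1| <= d -> `|p2 - q2| <= d ->
  `|two_phase p1 b1 p2 b2 i j - two_phase q1 b1 q2 b2 i j| <= d.
Proof.
move=> h1 h2; rewrite !two_phaseE; move: h1 h2; rewrite !ler_norml => /andP[? ?] /andP[? ?].
by case: ifP => _; case: (j == b1); case: (j == b2) => /=; apply/andP; split; lra.
Qed.

Section Perturbation.
Variables (R : realType) (u : 'M[R]_(2, 3)).
Hypothesis uE : example_payoff u.

Lemma marginE (p : R) b j (v := fun b : 'I_3 =>
    if b == actA then 0 else if b == actB then p / 2 - 1 / 6 else p - 1 / 2) :
  margin u p b j = v b - v j.
Proof.
have [eA eB eC] := uE (mix p); rewrite !mixE in eA eB eC.
by elim/learner_ind: b; elim/learner_ind: j; rewrite /margin ?eA ?eB ?eC /v /=; field.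
Qed.

(* Moving the first strategy off the boundary between two best-response regions
   turns the ties of the vertices into strict preferences. *)
Lemma vertex_perturbation (p1 p2 d : R) b1 b2 : (p1, b1, p2, b2) \in vertices R ->
  0 < d -> d <= 1 / 12 ->
  exists q1 q2, [/\ 0 <= q1 <= 1, 0 <= q2 <= 1, `|q1 - p1| <= d, `|q2 - p2| <= d &
   [/\ forall j, j != b1 -> d / 2 <= margin u q1 b1 j,
       forall j, j != b2 -> d / 12 <= margin u q1 b2 j / 2 + d * margin u q2 b2 j &
       forall j, j != b2 -> d / 12 <= margin u q1 b2 j / 2 + margin u q2 b2 j / 2]].
Proof.
move=> v d0 d1.
have solve q1 q2 : 0 <= q1 <= 1 -> 0 <= q2 <= 1 -> - d <= q1 - p1 <= d -> - d <= q2 - p2 <= d ->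
   [/\ forall j, j != b1 -> d / 2 <= margin u q1 b1 j,
       forall j, j != b2 -> d / 12 <= margin u q1 b2 j / 2 + d * margin u q2 b2 j &
       forall j, j != b2 -> d / 12 <= margin u q1 b2 j / 2 + margin u q2 b2 j / 2] ->
   exists q1 q2, [/\ 0 <= q1 <= 1, 0 <= q2 <= 1, `|q1 - p1| <= d, `|q2 - p2| <= d &
   [/\ forall j, j != b1 -> d / 2 <= margin u q1 b1 j,
       forall j, j != b2 -> d / 12 <= margin u q1 b2 j / 2 + d * margin u q2 b2 j &
       forall j, j != b2 -> d / 12 <= margin u q1 b2 j / 2 + margin u q2 b2 j / 2]].
  by move=> ? ? ? ? ?; exists q1, q2; rewrite !ler_norml.
have dd : d * d <= d * (1 / 12) by rewrite ler_pM2l.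
have dd0 : 0 <= d * d by rewrite mulr_ge0// ltW.
move: v; rewrite !inE; do 7?[case/orP]; move=> /eqP[e1 e2 e3 e4]; rewrite {}e1 {}e2 {}e3 {}e4 in solve *.
- apply: (solve 0 0); [lra|lra|lra|lra|].
  by split; elim/learner_ind => //= _; rewrite !marginE /=; lra.
- apply: (solve (1 / 3 - d) (1 / 3 - d)); [lra|lra|lra|lra|].
  by split; elim/learner_ind => //= _; rewrite !marginE /=; lra.
- apply: (solve (1 / 3 + d) (1 / 3 + d)); [lra|lra|lra|lra|].
  by split; elim/learner_ind => //= _; rewrite !marginE /=; lra.
- apply: (solve (2 / 3 - d) (2 / 3 - d)); [lra|lra|lra|lra|].
  by split; elim/learner_ind => //= _; rewrite !marginE /=; lra.
- apply: (solve (2 / 3 + d) (2 / 3 + d)); [lra|lra|lra|lra|].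
  by split; elim/learner_ind => //= _; rewrite !marginE /=; lra.
- apply: (solve 1 1); [lra|lra|lra|lra|].
  by split; elim/learner_ind => //= _; rewrite !marginE /=; lra.
(* In the first phase B trails A by [d / 2] per round, hence by [d / 4] per round of the horizon; a
   fraction [d] of the horizon against Y recovers [d / 3]. The difference is the [d / 12] of the
   statement. *)
- apply: (solve (1 / 3 - d) 1); [lra|lra|lra|lra|].
  by split; elim/learner_ind => //= _; rewrite !marginE /=; lra.
- apply: (solve (2 / 3 + d) 0); [lra|lra|lra|lra|].
  by split; elim/learner_ind => //= _; rewrite !marginE /=; lra.
Qed.

End Perturbation.

(** * Convergence of the menus *)

Lemma margin_le_half (R : realType) (u : 'M[R]_(2, 3)) (p : R) b j :
  example_payoff u -> 0 <= p <= 1 -> `|margin u p b j| <= 1 / 2.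
Proof.
move=> uE /andP[p0 p1]; rewrite marginE// ler_norml.
by elim/learner_ind: b; elim/learner_ind: j => /=; apply/andP; split; lra.
Qed.

Section FixedHorizon.
Variables (R : realType) (u : 'M[R]_(2, 3)) (T : nat) (eta : R).
Variables (reg : 'rV[R]_3 -> R) (A : learning_algorithm R 2 3) (B mu d : R).
Hypothesis T_gt0 : (0 < T)%N.
Hypothesis uE : example_payoff u.
Hypothesis eta0 : 0 < eta.
Hypothesis regB : forall y, simplex y -> `|reg y| <= B.
Hypothesis A_FTRL : plays_FTRL u T eta reg (A T).
Hypothesis mu0 : 0 < mu.
Hypothesis regC : forall (y z : 'rV[R]_3) (l : R), simplex y -> simplex z ->
  0 <= l <= 1 ->
  reg (l *: y + (1 - l) *: z) <= l * reg y + (1 - l) * reg z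
    - mu / 2 * l * (1 - l) * \sum_(j < 3) (y 0 j - z 0 j) ^+ 2.
Hypothesis d0 : 0 < d.
Hypothesis d1 : d <= 1 / 12.
Hypothesis dT : 48 <= d * T%:R.
Hypothesis rate : B * (eta^-1 / T%:R) <= d ^+ 3 / 288.
Hypothesis eta_small : eta <= mu * d.

(** A fraction [d] of the horizon serves both as the early rounds of the potential argument and as
    the transition at the start of each phase. *)
Let M := Num.truncn (d * T%:R).

Let M_bounds : d * T%:R - 1 <= M%:R <= d * T%:R.
Proof.
have dT' := dT; have T0 : 0 <= d * T%:R by lra.
have /andP[h1 h2] := truncn_itv T0.
by rewrite h1 andbT lerBlDr -(natrD _ _ 1) addn1 ltW.
Qed.

Let TR0 : 0 < T%:R :> R. Proof. by rewrite ltr0n. Qed.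

Let G_small : 2 * B / eta <= d ^+ 3 / 144 * T%:R.
Proof.
have : B * (eta^-1 / T%:R) * (2 * T%:R) <= d ^+ 3 / 288 * (2 * T%:R).
  by rewrite ler_pM2r// mulr_gt0.
have -> : B * (eta^-1 / T%:R) * (2 * T%:R) = 2 * B / eta.
  by field; rewrite !gt_eqF.
lra.
Qed.

Let B0 : 0 <= B.
Proof. exact: le_trans (normr_ge0 _) (regB (pure_simplex R actA)). Qed.

Lemma average_play_polytope (x : T.-tuple 'rV[R]_2) : (forall t, simplex (tnth x t)) ->
  regret_polytope (210 * d) (average_play A x).
Proof.
(* Padding with [mix 0] makes [X t] a strategy also beyond the horizon. *)
move=> xS; pose X t := nth (mix 0) x t.
have XS t : simplex (X t).
  rewrite /X; have [tT|Tt] := ltnP t T; last first.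
    by rewrite nth_default ?size_tuple//; apply: mix_simplex; lra.
  by have := xS (Ordinal tT); rewrite (tnth_nth (mix 0)).
rewrite (@average_playE _ _ _ A T x X); last by move=> t; rewrite (tnth_nth (mix 0)).
have /andP[M1 M2] := M_bounds; have GT := G_small.
have [dT' d0' d1'] := And3 dT d0 d1; have eta' := eta_small.
have D1 : 1 <= M%:R / 24 :> R by lra.
have DM : 24 * (M%:R / 24) <= M%:R :> R by lra.
have A_FTRL' : plays_FTRL u T.-1.+1 eta reg (A T) by rewrite prednK.
have := FTRL_average_polytope uE eta0 regB A_FTRL' mu0 regC XS D1 DM; rewrite prednK//.
apply: regret_polytope_mono.
rewrite (_ : 210 * d = 30 * (7 * d)); last by ring.
(* Of the budget [7 * d] per round, stability takes [2 * d], the cutoff [d] and the early rounds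
   [2 * d]; the rest covers [2 * G + 2]. *)
rewrite ler_pM2l// ler_pdivrMr//.
have k1 : 2 * eta / mu <= 2 * d by rewrite ler_pdivrMr//; lra.
have G0 : 0 <= 2 * B / eta by rewrite divr_ge0 ?mulr_ge0// ltW.
have k2 : 3 * (2 * B / eta) / (M%:R / 24) <= d.
  rewrite ler_pdivrMr; last lra.
  have : 0 <= d * (M%:R - d * T%:R / 2) by apply: mulr_ge0; lra.
  have : 0 <= d * (1 / 12 - d) * (d * T%:R) by rewrite !mulr_ge0//; lra.
  have : 0 <= d * (d * T%:R) by rewrite mulr_ge0//; lra.
  lra.
have nT : T.-1%:R * (2 * eta / mu + 3 * (2 * B / eta) / (M%:R / 24)) <= T%:R * (3 * d).
  apply: ler_pM => //; [|by rewrite ler_nat leq_pred|lra].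
  have M24 : 0 <= M%:R / 24 :> R by lra.
  have k0 : 0 <= 2 * eta / mu by rewrite divr_ge0 ?mulr_ge0// ltW.
  by apply: addr_ge0 => //; apply: divr_ge0 => //; exact: mulr_ge0.
have : 0 <= d * T%:R * (1 - d) * (1 + d) by rewrite !mulr_ge0//; lra.
lra.
Qed.

Lemma vertex_near_average (p1 p2 : R) b1 b2 : (p1, b1, p2, b2) \in vertices R ->
  exists2 x : T.-tuple 'rV[R]_2, (forall t, simplex (tnth x t)) &
    forall i j, `|two_phase p1 b1 p2 b2 i j - average_play A x i j| <= 4 * d.
Proof.
move=> /(vertex_perturbation uE)/(_ d0 d1)[q1 [q2 [q1P q2P q1d q2d [m1 m2 m3]]]].
pose X := phase_play q1 q2 T./2.
exists (mktuple (fun t : 'I_T => X t)).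
  by move=> t; rewrite tnth_mktuple /X /phase_play; case: ifP => _; exact: mix_simplex.
have -> : average_play A (mktuple (fun t : 'I_T => X t)) = history_average X (A T) T.
  by apply: average_playE => t; rewrite tnth_mktuple.
have /andP[M1 M2] := M_bounds; have GT := G_small.
have [dT' d0' d1'] := And3 dT d0 d1; have eta' := eta_small.
(* Below the lead of about [d ^+ 2 * T / 2] won in [M] rounds of the first phase. The second phase
   has about [d * T / 12], and the distance from there to [d * T / 16] is at least 1 by [dT], which
   pays for rounding [M] and [T./2]. *)
pose Delta := d ^+ 2 * T%:R / 24.
have Delta0 : 0 < Delta by rewrite /Delta divr_gt0// mulr_gt0// exprn_gt0.
have Delta16 : Delta <= d * T%:R / 16.
  have : 0 <= (1 - d) * (d * T%:R) by apply: mulr_ge0; lra.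
  by rewrite /Delta; lra.
have kE : T%:R = (odd T)%:R + 2 * (T./2)%:R :> R.
  by rewrite -natrM -natrD mul2n odd_double_half.
have {}kE : (T./2)%:R = (T%:R - (odd T)%:R) / 2 :> R by lra.
have half (m : R) : `|m| <= 1 / 2 -> (odd T)%:R * m <= 1 / 2.
  by rewrite ler_norml => /andP[? ?]; case: (odd T); rewrite /= ?mul1r ?mul0r; lra.
have mh p b j : 0 <= p <= 1 -> `|margin u p b j| <= 1 / 2 by exact: margin_le_half.
have near := FTRL_two_phase (b1 := b1) (b2 := b2) (M := M) eta0 regB A_FTRL T_gt0 q1P q2P Delta0.
move=> i j; have {}near := near _ _ _ i j.
have -> : two_phase p1 b1 p2 b2 i j - history_average X (A T) T i j =
    (two_phase p1 b1 p2 b2 i j - two_phase q1 b1 q2 b2 i j) -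
    (history_average X (A T) T i j - two_phase q1 b1 q2 b2 i j) by ring.
apply: le_trans (ler_normB _ _) _.
have t1 : `|two_phase p1 b1 p2 b2 i j - two_phase q1 b1 q2 b2 i j| <= d.
  by apply: two_phase_lipschitz; rewrite distrC.
have GD : 2 * B / eta / Delta <= d / 6.
  rewrite ler_pdivrMr// (le_trans GT)// /Delta.
  have : 0 <= d ^+ 3 * T%:R by rewrite mulr_ge0// exprn_ge0// ltW.
  lra.
have MT : (2 * M%:R + 1) / T%:R <= 5 / 2 * d by rewrite ler_pdivrMr//; lra.
suff : `|history_average X (A T) T i j - two_phase q1 b1 q2 b2 i j| <=
  2 * B / eta / Delta + (2 * M%:R + 1) / T%:R by lra.
apply: near => l lb.
- have h := m1 l lb; apply: le_trans (_ : M%:R * (d / 2) <= _); last by rewrite ler_wpM2l.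
  have : 0 <= (M%:R - d * T%:R / 2) * d by apply: mulr_ge0; lra.
  have : 0 <= d * (d * T%:R) by rewrite mulr_ge0//; lra.
  rewrite /Delta; lra.
- have h : T%:R * (d / 12) <= T%:R * (margin u q1 b2 l / 2 + d * margin u q2 b2 l).
    by rewrite ler_pM2l// m2.
  have := half _ (mh _ b2 l q1P); have := mh _ b2 l q2P; rewrite ler_norml => /andP[h1 h2].
  have : 0 <= (1 - (d * T%:R - M%:R)) * (1 / 2 + margin u q2 b2 l) by apply: mulr_ge0; lra.
  have : 0 <= (d * T%:R - M%:R) * (1 / 2 - margin u q2 b2 l) by apply: mulr_ge0; lra.
  rewrite kE; lra.
- have h : T%:R * (d / 12) <= T%:R * (margin u q1 b2 l / 2 + margin u q2 b2 l / 2).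
    by rewrite ler_pM2l// m3.
  have := half _ (mh _ b2 l q1P); have := half _ (mh _ b2 l q2P).
  rewrite kE; lra.
Qed.

End FixedHorizon.

(** From the menu, [regret_polytope_relax] costs [4 * 210 * d]. Conversely, the points within
    [4 * d] of the menu form a convex set that contains the vertices, hence the polytope; passing to
    the closure costs another [d]. *)
Lemma menu_close (R : realType) (u : 'M[R]_(2, 3)) (A : learning_algorithm R 2 3)
    (T : nat) (d : R) : example_payoff u -> 0 < d ->
  (forall x : T.-tuple 'rV[R]_2, (forall t, simplex (tnth x t)) ->
     regret_polytope (210 * d) (average_play A x)) ->
  (forall (p1 : R) b1 (p2 : R) b2, (p1, b1, p2, b2) \in vertices R ->
     exists2 x : T.-tuple 'rV[R]_2, (forall t, simplex (tnth x t)) &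
       forall i j, `|two_phase p1 b1 p2 b2 i j - average_play A x i j| <= 4 * d) ->
  (0 <= hausdorff_dist (menu A T) (M_MB u) <= (900 * d)%:E)%E.
Proof.
move=> uE d0 avgP vnear.
have d4 : 0 <= 4 * d by lra.
apply: hausdorff_dist_le; first by lra.
- have [|x xS _] := vnear 0 actA 0 actA; first by rewrite !inE eqxx.
  by exists (average_play A x); apply: convex_hull_sub; exists x.
- move=> D mD; have : regret_polytope (210 * d) D.
    apply: convex_hull_min mD; first exact: regret_polytope_convex.
    by move=> _ [x xS <-]; exact: avgP.
  have d210 : 0 <= 210 * d by lra.
  move=> /(regret_polytope_relax d210)[D' D'P DD']; exists D'.
    by apply: subset_closure; rewrite (profile_hull uE).
  by apply: ball_mx_norm => [|i j]; [lra|have := DD' i j; lra].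
- move=> D; rewrite /M_MB (profile_hull uE) => /(_ (ball D d)) [|D' [D'P DD']].
    exact: nbhsx_ballx.
  pose S : set 'M[R]_(2, 3) :=
    [set D | exists2 x, menu A T x & forall i j, `|D i j - x i j| <= 4 * d].
  have : S D'.
    apply: regret_polytope_sub D'P; last first.
      move=> p1 b1 p2 b2 /vnear[x xS xn]; exists (average_play A x) => //.
      by apply: convex_hull_sub; exists x.
    move=> x y l [x' mx xx'] [y' my yy'] l01.
    exists (l *: x' + (1 - l) *: y'); first exact: convex_hull_convex.
    move=> i j; rewrite !mxE.
    have -> : l * x i j + (1 - l) * y i j - (l * x' i j + (1 - l) * y' i j) =
      l * (x i j - x' i j) + (1 - l) * (y i j - y' i j) by ring.
    move: l01 => /andP[l0 l1]; have l0' : 0 <= 1 - l by lra.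
    apply: le_trans (ler_normD _ _) _; rewrite !normrM (ger0_norm l0) (ger0_norm l0').
    rewrite [leRHS](_ : _ = l * (4 * d) + (1 - l) * (4 * d)); last by ring.
    by apply: lerD; rewrite ler_wpM2l.
  case=> x mx D'x; exists x; first exact: mx.
  apply: ball_mx_norm => [|i j]; first lra.
  have := D'x i j; have [_ /(_ i j)] := DD'; rewrite -ball_normE /= => h1 h2.
  have -> : D i j - x i j = (D i j - D' i j) + (D' i j - x i j) by ring.
  by apply: le_lt_trans (ler_normD _ _) _; lra.
Qed.

Theorem theorem5p13 (R : realType) (uL : 'M[R]_(2, 3))
    (hNA : uL actN actA = 0) (hYA : uL actY actA = 0)
    (hNB : uL actN actB = - (1 / 6)) (hYB : uL actY actB = 1 / 3)
    (hNC : uL actN actC = - (1 / 2)) (hYC : uL actY actC = 1 / 2)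
    (A : learning_algorithm R 2 3) (reg : 'rV[R]_3 -> R) (eta : nat -> R)
    (hA : is_FTRL uL reg eta A)
    (heta : eta T @[T --> \oo] --> (0 : R)) :
  is_asymptotic_menu A (M_MB uL).
Proof.
have uE : example_payoff uL.
  move=> x; rewrite !payoff_pure !sum_optimizer hNA hYA hNB hYB hNC hYC.
  by split; field.
have [[B regB] [mu mu0 regC] [eta0 rate] A_FTRL] := hA.
have B0 : 0 <= B by apply: le_trans (regB _ (pure_simplex R actA)).
split; first exact: closed_closure.
have near_menu (e : R) : 0 < e ->
    \forall T \near \oo, (0 <= hausdorff_dist (menu A T) (M_MB uL) <= e%:E)%E.
  move=> e0; have [d [d0 d1 de]] : exists d : R, [/\ 0 < d, d <= 1 / 12 & 900 * d <= e].
    exists (Num.min (e / 900) (1 / 12)); rewrite ge_min lexx orbT lt_min; split=> //.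
      by apply/andP; split; lra.
    by have : Num.min (e / 900) (1 / 12) <= e / 900 by [rewrite ge_min lexx]; lra.
  (* [B] may be 0, so the threshold for the rate is divided by [B + 1]. *)
  have B1 : 0 < B + 1 by lra.
  have r0 : 0 < d ^+ 3 / 288 / (B + 1).
    have d3 : 0 < d ^+ 3 by exact: exprn_gt0.
    have d3' : 0 < d ^+ 3 / 288 by lra.
    exact: divr_gt0.
  have md0 : 0 < mu * d by rewrite mulr_gt0.
  near=> T.
  have T0 : (0 < T)%N by near: T; exact: nbhs_infty_gt.
  have dT : 48 <= d * T%:R.
    rewrite mulrC -ler_pdivrMr//; near: T; exact: nbhs_infty_ger.
  have rT : `|0 - (eta T)^-1 / T%:R| <= d ^+ 3 / 288 / (B + 1).
    by near: T; move/cvgrPdist_le : rate; apply.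
  (* This is where [heta] enters: it makes the stability error [2 * eta T / mu] at most [2 * d]. *)
  have etaT : `|0 - eta T| <= mu * d.
    by near: T; move/cvgrPdist_le : heta; apply.
  have rT' : B * ((eta T)^-1 / T%:R) <= d ^+ 3 / 288.
    have d3 : 0 <= d ^+ 3 / 288 / (B + 1) by exact: ltW.
    have rle : (eta T)^-1 / T%:R <= d ^+ 3 / 288 / (B + 1).
      by move: rT; rewrite sub0r normrN; apply: le_trans (ler_norm _).
    apply: le_trans (ler_wpM2l B0 rle) _.
    by rewrite -[leRHS](@divfK _ (B + 1)) ?gt_eqF// mulrC ler_wpM2l// lerDl ler01.
  have etaT' : eta T <= mu * d.
    by move: etaT; rewrite sub0r normrN; apply: le_trans (ler_norm _).
  have /andP[h0 h] : (0 <= hausdorff_dist (menu A T) (M_MB uL) <= (900 * d)%:E)%E.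
    apply: menu_close => //.
      exact: (average_play_polytope T0 uE (eta0 T T0) regB (A_FTRL T T0) mu0 regC d0 d1 dT
        rT' etaT').
    move=> p1 b1 p2 b2.
    exact: (vertex_near_average T0 uE (eta0 T T0) regB (A_FTRL T T0) d0 d1 dT rT'
      etaT').
  by apply/andP; split; [exact: h0|apply: le_trans h _; rewrite lee_fin].
(* Convergence of extended reals to 0: the distances are eventually finite, and their real values
   tend to 0. *)
apply/fine_cvgP; split.
  near=> T; have /andP[h0 h1] : (0 <= hausdorff_dist (menu A T) (M_MB uL) <= 1%:E)%E.
    by near: T; exact: near_menu.
  by rewrite ge0_fin_numE// (le_lt_trans h1)// ltry.
apply/cvgrPdist_le => e e0; near=> T.
have /andP[h0 h1] : (0 <= hausdorff_dist (menu A T) (M_MB uL) <= e%:E)%E.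
  by near: T; exact: near_menu.
rewrite sub0r normrN /= ger0_norm ?fine_ge0// -lee_fin fineK//.
by rewrite ge0_fin_numE// (le_lt_trans h1)// ltry.
Unshelve. all: by end_near.
Qed.
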